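(* Let $k$ be a flexible field of characteristic different from $2$. If $F/k$ is a finite extension of odd degree, then $\mathrm{k}^M_*(F/k)\cong\mathrm{k}^M_*(F/F)\cong\mathrm{k}^M_*(k/k)$, that is, $\mathbb{F}_2$ in degree $0$ and $0$ otherwise. In particular, it is a Koszul algebra.
   Context: A field $k$ is flexible if $k=k_0(t_1,t_2,\dots)$ is a purely transcendental extension of infinite degree of some field $k_0$ (a finite extension of a flexible field is flexible). $\mathrm{k}^M_*(F)$ is the mod 2 Milnor K-theory of a field $F$; a pure symbol is an element $\{a_1,\dots,a_n\}$. For a finitely generated field extension $F/k$ of a flexible field $k$, the isotropic Milnor K-theory $\mathrm{k}^M_*(F/k)$ is the quotient of $\mathrm{k}^M_*(F)$ by the ideal $I_k$ defined as the union of the annihilators of the images of non-zero pure symbols from $\mathrm{k}^M_*(k)$. Koszul algebras: for an $\mathbb{F}_2$-vector space $V$ and $R\subseteq V\otimes V$, the quadratic algebra is $A=T(V)/(R)$, and its Koszul dual coalgebra $A^{¡}$ is the subcoalgebra of the tensor coalgebra $T^c(V)$ given by $\mathbb{F}_2\oplus V\oplus R\oplus\cdots\oplus\big(\bigcap_{i+j=n-2}V^{\otimes i}\otimes R\otimes V^{\otimes j}\big)\oplus\cdots$. A quadratic algebra $A$ is Koszul if there is an isomorphism of coalgebras $A^{¡}\cong\mathrm{Tor}^A_*(\mathbb{F}_2,\mathbb{F}_2)$. *)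

(* Defs.v *)
Set Warnings "-notation-overridden,-ambiguous-paths,-notation-incompatible-prefix,-redundant-canonical-projection,-projection-no-head-constant".
From HB Require Import structures.
From mathcomp Require Import all_boot all_order all_algebra all_field.
From mathcomp Require Import generic_quotient ring_quotient.
From mathcomp Require Import boolp classical_sets.
From mathcomp Require Import finmap monalg.
From mathcomp Require mpoly.

Set Implicit Arguments.
Unset Strict Implicit.
Unset Printing Implicit Defensive.

Import GRing.Theory.

Local Open Scope classical_set_scope.
Local Open Scope ring_scope.
Local Open Scope quotient_scope.

Notation F2 := 'F_2.

Section Span.
Variable M : lmodType F2.
Implicit Types S U : set M.

Definition is_submod U := U 0 /\ forall c x y, U x -> U y -> U (c *: x + y).

Definition span S : set M := smallest is_submod S.

Lemma span_is_submod S : is_submod (span S).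
Proof.
split=> [U [[U0 _] _]|c x y Sx Sy U SU] //.
by have [[_ Uc] _] := SU; apply: Uc; [exact: (Sx U)|exact: (Sy U)].
Qed.

Lemma sub_span S : S `<=` span S.
Proof. exact: sub_gen_smallest. Qed.

Lemma span_sub S U : is_submod U -> S `<=` U -> span S `<=` U.
Proof. exact: smallest_sub. Qed.

Definition spanp S : {pred M} := fun x => `[< span S x >].

Lemma spanpP S x : reflect (span S x) (x \in spanp S).
Proof. exact: asboolP. Qed.

Fact spanp_submod_closed S : submod_closed (spanp S).
Proof.
have [S0 SD] := span_is_submod S.
split; first exact/spanpP.
by move=> c x y /spanpP Sx /spanpP Sy; apply/spanpP; exact: SD.
Qed.
HB.instance Definition _ S :=
  GRing.isSubmodClosed.Build F2 M (spanp S) (spanp_submod_closed S).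

(* The subspace spanned by [S], as a type. *)
Definition subspace S := {x : M | x \in spanp S}.

HB.instance Definition _ S := SubChoice.on (subspace S).
HB.instance Definition _ S := [SubChoice_isSubLmodule of subspace S by <:].

(* The quotient of [M] by the subspace spanned by [S]. *)
Definition qmod S := {ideal_quot (spanp S)}.

HB.instance Definition _ S := GRing.Zmodule.on (qmod S).

End Span.

HB.lock Definition qpi (M : lmodType F2) (S : set M) (x : M) : qmod S :=
  \pi_{ideal_quot (spanp S)} x.
HB.lock Definition qrepr (M : lmodType F2) (S : set M) (x : qmod S) : M :=
  repr (x : {ideal_quot (spanp S)}).
Arguments qpi {M} S x.
Arguments qrepr {M} S x.

Section Quotient.
Variable M : lmodType F2.
Implicit Types S U : set M.

Lemma qreprK S : cancel (@qrepr M S) (@qpi M S).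
Proof. by move=> x; rewrite qpi.unlock qrepr.unlock reprK. Qed.

Lemma qpiD S : {morph @qpi M S : x y / x + y}.
Proof. by move=> x y; rewrite qpi.unlock (raddfD \pi_{ideal_quot (spanp S)}). Qed.

Lemma qpiP S x y : (qpi S x = qpi S y) <-> span S (x - y).
Proof.
rewrite qpi.unlock; split=> [/eqP|h]; first by rewrite piE Quotient.equivE => /spanpP.
by apply/eqP; rewrite piE Quotient.equivE; apply/spanpP.
Qed.

Lemma qrepr_pi S x : span S (qrepr S (qpi S x) - x).
Proof. by apply/qpiP; rewrite qreprK. Qed.

Definition qscale S c (x : qmod S) := qpi S (c *: qrepr S x).

Lemma qscale_pi S c x : qscale c (qpi S x) = qpi S (c *: x).
Proof.
apply/qpiP; rewrite -scalerBr -[X in span _ X]addr0.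
have [S0 SD] := span_is_submod S; apply: SD => //; exact: qrepr_pi.
Qed.

Fact qscaleA S a b (x : qmod S) : qscale a (qscale b x) = qscale (a * b) x.
Proof. by rewrite -[x]qreprK !qscale_pi scalerA. Qed.
Fact qscale1 S : left_id 1 (@qscale S).
Proof. by move=> x; rewrite -[x]qreprK !qscale_pi scale1r. Qed.
Fact qscaleDr S : right_distributive (@qscale S) +%R.
Proof.
by move=> c x y; rewrite -[x]qreprK -[y]qreprK -qpiD !qscale_pi scalerDr qpiD.
Qed.
Fact qscaleDl S (x : qmod S) : {morph (@qscale S)^~ x : a b / a + b}.
Proof. by move=> a b; rewrite -[x]qreprK !qscale_pi scalerDl qpiD. Qed.
HB.instance Definition _ S := GRing.Zmodule_isLmodule.Build F2 (qmod S)
  (@qscaleA S) (@qscale1 S) (@qscaleDr S) (@qscaleDl S).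

Fact qpi_linear S : linear (@qpi M S).
Proof. by move=> c x y; rewrite qpiD -qscale_pi. Qed.
HB.instance Definition _ S :=
  GRing.isLinear.Build F2 M (qmod S) _ (@qpi M S) (@qpi_linear S).

End Quotient.

(* An F2-algebra is a ring of characteristic 2: its scalar multiplication is
   determined by its ring structure, and additive maps are linear.  The library's
   [algType] is not used because it excludes the zero algebra, which quotients by
   an arbitrary two-sided ideal may produce. *)
HB.mixin Record hasChar2 A of GRing.PzRing A := {
  char2 : 2%:R = 0 :> A
}.

#[short(type="f2algType")]
HB.structure Definition F2Algebra := {A of GRing.PzRing A & hasChar2 A}.

(* The vector space underlying an F2-algebra. *)
Definition vec (A : f2algType) : Type := A.

Section Vec.
Variable A : f2algType.

HB.instance Definition _ := GRing.Zmodule.on (vec A).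

Definition f2scale (c : F2) (x : vec A) : vec A := x *+ c.

Lemma f2P (c : F2) : c = 0 \/ c = 1.
Proof. by case: c => [[|[|//]] i]; [left|right]; exact: val_inj. Qed.

Lemma addrr2 (x : vec A) : x + x = 0.
Proof.
have := @char2 A => /(congr1 (fun y => y * (x : A))).
by rewrite mul0r mulr_natl.
Qed.

Fact f2scaleA a b x : f2scale a (f2scale b x) = f2scale (a * b) x.
Proof.
by have [->|->] := f2P a; have [->|->] := f2P b;
   rewrite /f2scale ?mulr0n ?mulr1n ?mul0rn.
Qed.
Fact f2scale1 : left_id 1 f2scale. Proof. by move=> x. Qed.
Fact f2scaleDr : right_distributive f2scale +%R.
Proof. by move=> c x y; rewrite /f2scale mulrnDl. Qed.
Fact f2scaleDl x : {morph f2scale^~ x : a b / a + b}.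
Proof.
by move=> a b; have [->|->] := f2P a; have [->|->] := f2P b;
   rewrite /f2scale /= ?mulr0n ?mulr1n ?addr0 ?add0r ?addrr2.
Qed.
HB.instance Definition _ := GRing.Zmodule_isLmodule.Build F2 (vec A)
  f2scaleA f2scale1 f2scaleDr f2scaleDl.

End Vec.

Fact F2_char2 : 2%:R = 0 :> F2. Proof. exact: val_inj. Qed.
HB.instance Definition _ := hasChar2.Build F2 F2_char2.

Section AlgebraQuotient.
Variable A : f2algType.
Implicit Types S U : set A.

Definition is_ideal U :=
  @is_submod (vec A) U /\ forall a x, U x -> U (a * x) /\ U (x * a).

Definition ideal_gen S : set A := smallest is_ideal S.

Lemma ideal_gen_is_ideal S : is_ideal (ideal_gen S).
Proof.
split=> [|a x Sx]; first split=> [U [[[U0 _] _] _]|c x y Sx Sy U SU] //.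
  by have [[[_ Uc] _] _] := SU; apply: Uc; [exact: (Sx U)|exact: (Sy U)].
by split=> U SU; have [[_ UM] _] := SU; have [] := UM a x (Sx U SU).
Qed.

Lemma sub_ideal_gen S : S `<=` ideal_gen S.
Proof. exact: sub_gen_smallest. Qed.

Lemma ideal_gen_sub S U : is_ideal U -> S `<=` U -> ideal_gen S `<=` U.
Proof. exact: smallest_sub. Qed.

Lemma span_ideal_gen S : @span (vec A) (ideal_gen S) = ideal_gen S.
Proof. by apply: smallest_id; have [] := ideal_gen_is_ideal S. Qed.

(* The quotient of [A] by the two-sided ideal generated by [S]. *)
Definition qalg S : Type := @qmod (vec A) (ideal_gen S).

HB.instance Definition _ S := GRing.Zmodule.on (qalg S).

End AlgebraQuotient.

Section AlgebraQuotientRing.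
Variable A : f2algType.
Implicit Types S U : set A.

Definition api S (x : A) : qalg S := @qpi (vec A) (ideal_gen S) x.
Definition arepr S (x : qalg S) : A := @qrepr (vec A) (ideal_gen S) x.

Lemma areprK S : cancel (@arepr S) (@api S). Proof. exact: qreprK. Qed.

Lemma apiP S x y : api S x = api S y <-> ideal_gen S (x - y).
Proof. by have := @qpiP (vec A) (ideal_gen S) x y; rewrite span_ideal_gen. Qed.

Lemma apiD S : {morph @api S : x y / x + y}.
Proof. exact: (@qpiD (vec A) (ideal_gen S)). Qed.

End AlgebraQuotientRing.

Arguments api {A} S x.
Arguments arepr {A} S x.

HB.lock Definition qmul (A : f2algType) (S : set A) (x y : qalg S) : qalg S :=
  api S (arepr S x * arepr S y).

Section AlgebraQuotientLaws.
Variable A : f2algType.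
Implicit Types S U : set A.

Definition qone S : qalg S := api S 1.

Lemma qmul_pi S x y : qmul (api S x) (api S y) = api S (x * y).
Proof.
have [_ SM] := ideal_gen_is_ideal S.
rewrite qmul.unlock.
apply: (@etrans _ _ (api S (x * arepr S (api S y)))); apply/apiP.
  by rewrite -mulrBl; apply: (SM _ _ _).2; apply/apiP; rewrite areprK.
by rewrite -mulrBr; apply: (SM _ _ _).1; apply/apiP; rewrite areprK.
Qed.

Fact qmulA S : associative (@qmul A S).
Proof.
by move=> x y z; rewrite -[x]areprK -[y]areprK -[z]areprK !qmul_pi mulrA.
Qed.
Fact qmul1l S : left_id (qone S) (@qmul A S).
Proof. by move=> x; rewrite -[x]areprK qmul_pi mul1r. Qed.
Fact qmul1r S : right_id (qone S) (@qmul A S).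
Proof. by move=> x; rewrite -[x]areprK qmul_pi mulr1. Qed.
Fact qmulDl S : left_distributive (@qmul A S) +%R.
Proof.
move=> x y z; rewrite -[x]areprK -[y]areprK -[z]areprK.
by rewrite -apiD !qmul_pi mulrDl apiD.
Qed.
Fact qmulDr S : right_distributive (@qmul A S) +%R.
Proof.
move=> x y z; rewrite -[x]areprK -[y]areprK -[z]areprK.
by rewrite -apiD !qmul_pi mulrDr apiD.
Qed.
HB.instance Definition _ S := GRing.Zmodule_isPzRing.Build (qalg S)
  (@qmulA S) (@qmul1l S) (@qmul1r S) (@qmulDl S) (@qmulDr S).

Lemma apiM S : {morph @api A S : x y / x * y}.
Proof. by move=> x y; rewrite -qmul_pi. Qed.

Lemma api1 S : api S 1 = 1. Proof. by []. Qed.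

Fact qalg_char2 S : 2%:R = 0 :> qalg S.
Proof.
rewrite mulr2n -api1 -apiD; have := @char2 A; rewrite mulr2n => ->.
by apply: (@addrI _ (api S 0)); rewrite -apiD !addr0.
Qed.
HB.instance Definition _ S := hasChar2.Build (qalg S) (@qalg_char2 S).

End AlgebraQuotientLaws.

Section FreeModule.
Variables (K : choiceType) (W : lmodType F2).

Definition flin (f : K -> W) (x : {malg F2[K]}) : W :=
  \sum_(k <- msupp x) x@_k *: f k.

Lemma flinEw f x (D : {fset K}) : (msupp x `<=` D)%fset ->
  flin f x = \sum_(k <- D) x@_k *: f k.
Proof.
move=> le; rewrite /flin (big_fset_incl _ le) // => k _.
by move/mcoeff_outdom => ->; rewrite scale0r.
Qed.

Fact flin_linear f : linear (flin f).
Proof.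
move=> c x y; set D := (msupp x `|` msupp y)%fset.
have Dx : (msupp x `<=` D)%fset by exact: fsubsetUl.
have Dy : (msupp y `<=` D)%fset by exact: fsubsetUr.
have Dxy : (msupp (c *: x + y) `<=` D)%fset.
  apply/fsubsetP => k; rewrite -!mcoeff_neq0 mcoeffD mcoeffZ in_fsetU.
  rewrite -!mcoeff_neq0; apply: contraR; rewrite negb_or !negbK.
  by move=> /andP[/eqP -> /eqP ->]; rewrite mulr0 addr0.
rewrite (flinEw _ Dxy) (flinEw _ Dx) (flinEw _ Dy) scaler_sumr -big_split /=.
by apply: eq_bigr => k _; rewrite mcoeffD mcoeffZ scalerDl scalerA.
Qed.
HB.instance Definition _ f :=
  GRing.isLinear.Build F2 {malg F2[K]} W _ (flin f) (flin_linear f).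

Lemma flinU f k : flin f << k >> = f k.
Proof.
by rewrite (flinEw _ msuppU_le) big_seq_fset1 mcoeffUU scale1r.
Qed.

Lemma flin_uniq (g : {linear {malg F2[K]} -> W}) x :
  g x = flin (fun k => g << k >>) x.
Proof.
rewrite {1}[x]monalgE raddf_sum; apply: eq_bigr => k _ /=.
by rewrite -linearZ /=; congr (g _); apply/malgP => j;
   rewrite mcoeffZ !mcoeffU mulr_natr.
Qed.

End FreeModule.

Lemma malgF2E (K : choiceType) (x : {malg F2[K]}) :
  x = \sum_(k <- msupp x) << k >>.
Proof.
rewrite {1}[x]monalgE; apply: eq_big_seq => k; rewrite -mcoeff_neq0.
by have [->|->] := f2P x@_k; rewrite ?eqxx.
Qed.

Fact malg_char2 (K : monomType) : 2%:R = 0 :> {malg F2[K]}.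
Proof. by rewrite -scaler_nat F2_char2 scale0r. Qed.
HB.instance Definition _ (K : monomType) :=
  hasChar2.Build {malg F2[K]} (@malg_char2 K).

(* The noncommutative polynomial algebra on the set [X], and its words. *)
Definition free_alg (X : choiceType) : Type := {malg F2[{fmonom X}]}.

HB.instance Definition _ X := GRing.Zmodule.on (free_alg X).

HB.lock Definition fmul (X : choiceType) (x y : free_alg X) : free_alg X :=
  (x : {malg F2[{fmonom X}]}) * y.

HB.lock Definition fword (X : choiceType) (s : seq X) : free_alg X :=
  << FMonom s >>.

Section FreeAlgebra.
Variable X : choiceType.

Fact fmulA : associative (@fmul X).
Proof. by move=> x y z; rewrite fmul.unlock mulrA. Qed.
Fact fmul1l : left_id (1 : {malg F2[{fmonom X}]}) (@fmul X).
Proof. by move=> x; rewrite fmul.unlock mul1r. Qed.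
Fact fmul1r : right_id (1 : {malg F2[{fmonom X}]}) (@fmul X).
Proof. by move=> x; rewrite fmul.unlock mulr1. Qed.
Fact fmulDl : left_distributive (@fmul X) +%R.
Proof. by move=> x y z; rewrite fmul.unlock mulrDl. Qed.
Fact fmulDr : right_distributive (@fmul X) +%R.
Proof. by move=> x y z; rewrite fmul.unlock mulrDr. Qed.
HB.instance Definition _ := GRing.Zmodule_isPzRing.Build (free_alg X)
  fmulA fmul1l fmul1r fmulDl fmulDr.
HB.instance Definition _ := hasChar2.Build (free_alg X) (@malg_char2 _).

Lemma fword0 : fword [::] = 1 :> free_alg X.
Proof. by rewrite fword.unlock -fmoneE. Qed.

Lemma fword_cat (s t : seq X) : fword (s ++ t) = fword s * fword t.
Proof.
by rewrite /GRing.mul /= fmul.unlock fword.unlock malgM_def fgmulUU mulr1 /mmul /= fmmulE.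
Qed.

Lemma free_alg_words (a : free_alg X) :
  exists s : seq (seq X), a = \sum_(w <- s) fword w.
Proof.
exists (map (@fmonom_val X) (msupp (a : {malg F2[{fmonom X}]}))).
rewrite [LHS](malgF2E (a : {malg F2[{fmonom X}]})) big_map.
by apply: eq_bigr => m _; rewrite fword.unlock fmK.
Qed.

End FreeAlgebra.

Section TensorAlgebra.
Variable V : lmodType F2.

(* Additivity in each letter suffices: over F2 it implies linearity. *)
Definition tensor_alg_rel : set (free_alg V) :=
  [set x | exists u v, x = fword [:: u + v] - fword [:: u] - fword [:: v]].

Definition tensor_alg : Type := qalg tensor_alg_rel.

HB.instance Definition _ := F2Algebra.on tensor_alg.

(* The pure tensor of the vectors in [s]. *)
Definition tword (s : seq V) : vec tensor_alg := api tensor_alg_rel (fword s).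

(* The summand of tensors of degree [n]. *)
Definition tdeg n : set (vec tensor_alg) :=
  span [set x | exists2 s, size s = n & x = tword s].

Lemma tword_cat s t : tword (s ++ t) = (tword s : tensor_alg) * tword t.
Proof. by rewrite /tword fword_cat apiM. Qed.

Lemma twordD u v s t :
  tword (s ++ (u + v) :: t) = tword (s ++ u :: t) + tword (s ++ v :: t).
Proof.
rewrite -[_ :: t]cat1s -[u :: t]cat1s -[v :: t]cat1s !tword_cat.
set a := tword s; set b := tword t.
suff -> : tword [:: u + v] = tword [:: u] + tword [:: v].
  by rewrite [X in _ * X = _]mulrDl mulrDr.
rewrite /tword -apiD; apply/apiP; apply: sub_ideal_gen.
by exists u, v; rewrite opprD addrA.
Qed.

Variable W : lmodType F2.
Implicit Type f : seq V -> W.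

Definition multiadditive f := forall s t u v,
  f (s ++ (u + v) :: t) = f (s ++ u :: t) + f (s ++ v :: t).

(* The linear map sending each pure tensor [tword s] to [f s]. *)
Definition tlift f (x : vec tensor_alg) : W :=
  flin (fun m : {fmonom V} => f m) (arepr tensor_alg_rel x).

Lemma flin_tensor_alg_rel f x : multiadditive f ->
  ideal_gen tensor_alg_rel x -> flin (fun m : {fmonom V} => f m) x = 0.
Proof.
move=> fD relx.
pose g : free_alg V -> W := flin (fun m : {fmonom V} => f m); rewrite -[LHS]/(g x).
have gD : {morph g : y z / y + z} by exact: (raddfD (flin _)).
have gB : {morph g : y z / y - z} by exact: (raddfB (flin _)).
have g0 : g 0 = 0 by exact: (raddf0 (flin _)).
have gU w : g (fword w) = f w by rewrite fword.unlock; exact: flinU.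
have gsum := big_morph g gD g0; clearbody g.
pose U : set (free_alg V) := [set y | forall l r, g (fword l * y * fword r) = 0].
suff Ux : U x by have := Ux [::] [::]; rewrite fword0 mul1r mulr1.
apply: (@ideal_gen_sub _ _ U) relx => [|_ [u [v ->]] l r]; last first.
  have gw w : g (fword l * fword [:: w] * fword r) = f (l ++ w :: r).
    by rewrite -2!fword_cat gU -catA.
  rewrite 2!mulrBr 2!mulrBl 2!gB !gw fD.
  by rewrite [X in X - _ - _]addrC addrK subrr.
split; first split.
- by move=> l r; rewrite mulr0 mul0r.
- move=> c y z Uy Uz.
  have [->|->] := f2P c; first by rewrite scale0r add0r.
  by rewrite scale1r => l r; rewrite [X in X * _]mulrDr mulrDl gD Uy Uz addr0.
- move=> a y Uy; split=> l r; have [s ->] := free_alg_words a.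
    rewrite mulr_suml mulr_sumr mulr_suml gsum big1 // => w _.
    by rewrite mulrA -fword_cat; apply: Uy.
  rewrite mulr_sumr mulr_sumr mulr_suml gsum big1 // => w _.
  by rewrite !mulrA -[_ * _ * _]mulrA -fword_cat; apply: Uy.
Qed.

Lemma tlift_word f s : multiadditive f -> tlift f (tword s) = f s.
Proof.
move=> fD; apply/eqP; rewrite -subr_eq0 /tlift.
have -> : f s = flin (fun m : {fmonom V} => f m) (fword s) by rewrite fword.unlock flinU.
rewrite -raddfB; apply/eqP/flin_tensor_alg_rel => //.
by apply/apiP; rewrite areprK.
Qed.

Lemma tliftD f : multiadditive f -> {morph tlift f : x y / x + y}.
Proof.
move=> fD x y; apply/eqP; rewrite -subr_eq0 /tlift -raddfD -raddfB.
apply/eqP/flin_tensor_alg_rel => //; apply/apiP.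
by rewrite apiD !areprK.
Qed.

End TensorAlgebra.

Section TensorProduct.
Variables U W : lmodType F2.

Definition tensor_rel : set {malg F2[(U * W)%type]} :=
  [set x | (exists u u' w, x = << (u + u', w) >> - << (u, w) >> - << (u', w) >>)
        \/ (exists u w w', x = << (u, w + w') >> - << (u, w) >> - << (u, w') >>)].

Definition tensor : Type := qmod tensor_rel.

HB.instance Definition _ := GRing.Lmodule.on tensor.

Definition tens u w : tensor := qpi tensor_rel << (u, w) >>.

Lemma tensDl u u' w : tens (u + u') w = tens u w + tens u' w.
Proof.
rewrite /tens -qpiD; apply/qpiP; apply: sub_span; left.
by exists u, u', w; rewrite opprD addrA.
Qed.

Lemma tensDr u w w' : tens u (w + w') = tens u w + tens u w'.
Proof.
rewrite /tens -qpiD; apply/qpiP; apply: sub_span; right.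
by exists u, w, w'; rewrite opprD addrA.
Qed.

Variable X : lmodType F2.
Implicit Type h : U -> W -> X.

Definition biadditive h :=
  (forall w, {morph h^~ w : u u' / u + u'}) /\
  (forall u, {morph h u : w w' / w + w'}).

(* The linear map sending each [tens u w] to [h u w]. *)
Definition tens_lift h (x : tensor) : X := flin (fun p => h p.1 p.2) (qrepr tensor_rel x).

Lemma flin_tensor_rel h x : biadditive h ->
  span tensor_rel x -> flin (fun p => h p.1 p.2) x = 0.
Proof.
move=> [hl hr] relx; set g := flin _.
apply: (@span_sub _ _ [set y | g y = 0]) relx => [|y].
  split=> [|c y z /= gy gz]; first by rewrite /= /g raddf0.
  by rewrite /g linearP /= -/g gy gz scaler0 addr0.
by case=> [[u [u' [w ->]]]|[u [w [w' ->]]]] /=;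
   rewrite /g !raddfB /= !flinU /= (hl, hr) [X in X - _ - _]addrC addrK subrr.
Qed.

Lemma tens_lift_tens h u w : biadditive h -> tens_lift h (tens u w) = h u w.
Proof.
move=> hD; apply/eqP; rewrite -subr_eq0 /tens_lift.
have -> : h u w = flin (fun p => h p.1 p.2) << (u, w) >> by rewrite flinU.
rewrite -raddfB; apply/eqP/flin_tensor_rel => //; exact: qrepr_pi.
Qed.

Lemma tens_liftD h : biadditive h -> {morph tens_lift h : x y / x + y}.
Proof.
move=> hD x y; apply/eqP; rewrite -subr_eq0 /tens_lift -raddfD -raddfB.
apply/eqP/flin_tensor_rel => //; apply/qpiP.
by rewrite qpiD !qreprK.
Qed.

End TensorProduct.

Definition tmap (U W U' W' : lmodType F2) (f : U -> U') (g : W -> W') :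
  tensor U W -> tensor U' W' := tens_lift (fun u w => tens (f u) (g w)).

Section TensorCoalgebra.
Variable V : lmodType F2.

(* The deconcatenation coproduct and the counit of the tensor coalgebra, whose
   underlying space is that of the tensor algebra. *)
Definition deconcat_word (s : seq V) : tensor (vec (tensor_alg V)) (vec (tensor_alg V)) :=
  \sum_(i < (size s).+1) tens (tword (take i s)) (tword (drop i s)).

Definition deconcat := tlift deconcat_word.

Definition tcounit_word (s : seq V) : F2^o := (nilp s)%:R.

Definition tcounit := tlift tcounit_word.

Lemma deconcat_multiadditive : multiadditive deconcat_word.
Proof.
move=> s t u v; rewrite /deconcat_word !size_cat /= -big_split /=.
apply: eq_bigr => i _; rewrite !take_cat !drop_cat.
case: ltnP => hi; first by rewrite twordD tensDr.
case: (i - size s)%N => [|j] /=; first by rewrite (twordD _ _ [::]) tensDr.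
by rewrite twordD tensDl.
Qed.

Lemma tcounit_multiadditive : multiadditive tcounit_word.
Proof. by move=> s t u v; rewrite /tcounit_word; case: s => [|a s]; rewrite /= addr0. Qed.

End TensorCoalgebra.

(* An algebra with its homogeneous components.  The axioms of a grading are not
   recorded: they hold for every algebra constructed below. *)
Record galg := GAlg {
  galg_sort :> f2algType;
  adeg : nat -> set galg_sort
}.

Definition galg_iso (A B : galg) : Prop :=
  exists f : {rmorphism A -> B},
    bijective f /\ forall n x, adeg n x <-> adeg n (f x).

(* F2 concentrated in degree 0. *)
Definition galg_F2 : galg :=
  @GAlg F2 (fun n => if n is 0%N then setT else [set 0]).

(* The data of a graded coalgebra; likewise, the axioms hold for [kdual] and [tor]. *)
Record gcoalg := GCoalg {
  gcoalg_sort :> lmodType F2;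
  cdeg : nat -> set gcoalg_sort;
  comul : gcoalg_sort -> tensor gcoalg_sort gcoalg_sort;
  counit : gcoalg_sort -> F2
}.

Definition gcoalg_iso (C D : gcoalg) : Prop :=
  exists f : {linear C -> D},
    [/\ bijective f,
        forall n x, cdeg n x <-> cdeg n (f x),
        forall x, counit (f x) = counit x
      & forall x, comul (f x) = tmap f f (comul x)].

Section Quadratic.
Variables (V : lmodType F2) (R : set (vec (tensor_alg V))).

Definition quadratic_alg : galg :=
  @GAlg (qalg (R : set (tensor_alg V)))
    (fun n => [set api R x | x in tdeg n]).

(* In degree n, the intersection of the V^i (x) R (x) V^j with i + j + 2 = n;
   for n = 0, 1 this is all of V^n. *)
Definition kdual_deg n : set (vec (tensor_alg V)) :=
  [set x | tdeg n x /\ forall i j, (i + j + 2)%N = n ->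
     span [set y : vec (tensor_alg V) | exists a r b : tensor_alg V,
       [/\ tdeg i a, R r, tdeg j b & y = a * r * b]] x].

Definition kdual_space := subspace (\bigcup_n kdual_deg n).

(* The restriction of the deconcatenation coproduct: the unique preimage of
   [deconcat (val x)] under the inclusion of the tensor square of the Koszul dual
   into that of T(V). *)
Definition kdual_comul (x : kdual_space) : tensor kdual_space kdual_space :=
  xget 0 [set w | tmap val val w = deconcat (val x)].

Definition kdual : gcoalg :=
  @GCoalg kdual_space (fun n => [set x | kdual_deg n (val x)])
    kdual_comul (fun x => tcounit (val x)).

End Quadratic.

(* The coalgebra Tor^A(F2, F2) is the homology of the reduced bar complex of A,
   that is of the tensor coalgebra on the augmentation ideal of A with differential
     d [a1|..|an] = sum_i [a1|..|ai a_(i+1)|..|an],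
   realised inside the tensor algebra on the whole of A. *)
Section Tor.
Variable A : galg.

Definition aug_ideal : set (vec A) :=
  span [set a : vec A | exists2 n, (0 < n)%N & adeg n a].

Definition bar_ambient : lmodType F2 := vec (tensor_alg (vec A)).

Definition bar : set bar_ambient :=
  span [set x | exists2 s : seq (vec A),
    (forall a, a \in s -> aug_ideal a) & x = tword s].

Fixpoint bar_dword (s : seq (vec A)) : bar_ambient :=
  if s is a :: s' then
    if s' is b :: r then
      tword ((a : A) * b :: r : seq (vec A))
        + (tword [:: a] : tensor_alg (vec A)) * bar_dword s'
    else 0
  else 0.

Definition bar_d : bar_ambient -> bar_ambient := tlift bar_dword.

Lemma bar_dword_multiadditive : multiadditive bar_dword.
Proof.
have dcons (a b : vec A) r : bar_dword (a :: b :: r) =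
    tword ((a : A) * b :: r : seq (vec A))
      + (tword [:: a] : tensor_alg (vec A)) * bar_dword (b :: r) by [].
have tD1 u v t :
    tword (u + v :: t : seq (vec A)) = tword (u :: t) + tword (v :: t).
  exact: (twordD u v [::] t).
have d0 t u v :
    bar_dword (u + v :: t) = bar_dword (u :: t) + bar_dword (v :: t).
  case: t => [|b t]; first by rewrite /= addr0.
  rewrite 3!dcons [((u + v : vec A) : A) * b]mulrDl tD1 (tD1 _ _ [::]).
  by rewrite [X in _ + X = _]mulrDl addrACA.
elim=> [|a s IH] t u v; first exact: d0.
case: s IH => [|b s] IH; rewrite !cat_cons.
  rewrite !cat0s 3!dcons d0 [(a : A) * (u + v : vec A)]mulrDr tD1.
  by rewrite [X in _ + X = _]mulrDr addrACA.
have := IH t u v; rewrite !cat_cons => IHt.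
rewrite 3!dcons IHt -!cat_cons twordD.
by rewrite [X in _ + X = _]mulrDr addrACA.
Qed.

(* The differential of the tensor product of the bar complex with itself. *)
Definition bar2_d (x : tensor bar_ambient bar_ambient) :
  tensor bar_ambient bar_ambient := tmap bar_d id x + tmap id bar_d x.

Definition bar2 : set (tensor bar_ambient bar_ambient) :=
  span [set x | exists y z, [/\ bar y, bar z & x = tens y z]].

Definition bar_cycles := subspace [set x | bar x /\ bar_d x = 0].

Definition bar_boundaries : set bar_cycles :=
  [set z | exists2 y, bar y & val z = bar_d y].

Definition tor_space := qmod bar_boundaries.

Definition tor_class (z : bar_cycles) : tor_space := qpi bar_boundaries z.

Definition tor_deg n : set tor_space :=
  [set tor_class z | z in [set z | tdeg n (val z)]].

(* By the Kunneth theorem, the coproduct of the class of a cycle [z] is the unique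
   [w] whose image in the homology of the tensor square of the bar complex is the
   class of [deconcat z]. *)
Definition tor_comul (h : tor_space) : tensor tor_space tor_space :=
  xget 0 [set w | exists z (c : tensor bar_cycles bar_cycles),
    [/\ tor_class z = h, tmap tor_class tor_class c = w
      & exists2 b, bar2 b & deconcat (val z) - tmap val val c = bar2_d b]].

Definition tor : gcoalg :=
  @GCoalg tor_space tor_deg tor_comul
    (fun h => tcounit (val (qrepr bar_boundaries h))).

End Tor.

(* [R] is a subspace of V (x) V, and the isomorphism of coalgebras respects the
   gradings. *)
Definition koszul (A : galg) : Prop :=
  exists (V : lmodType F2) (R : set (vec (tensor_alg V))),
    [/\ is_submod R, R `<=` tdeg 2, galg_iso A (quadratic_alg R)
      & gcoalg_iso (kdual R) (tor A)].

Section Milnor.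
Variable F : fieldType.

Definition funits := {a : F | a != 0}.

HB.instance Definition _ := Choice.on funits.

Definition milnor_rel : set (free_alg funits) :=
  [set x | (exists a b c : funits, val c = val a * val b /\
              x = fword [:: c] - fword [:: a] - fword [:: b])
        \/ (exists a b : funits, val a + val b = 1 /\ x = fword [:: a; b])].

Definition milnor : f2algType := qalg milnor_rel.

Definition symbol (s : seq funits) : milnor := api milnor_rel (fword s).

Definition milnor_deg n : set milnor :=
  @span (vec milnor) [set x | exists2 s, size s = n & x = symbol s].

End Milnor.

Section IsotropicMilnor.
Variables (k F : fieldType) (i : {rmorphism k -> F}).

Fact funits_map_subproof (a : funits k) : i (val a) != 0.
Proof. by rewrite fmorph_eq0 (valP a). Qed.

Definition funits_map (a : funits k) : funits F :=
  exist _ (i (val a)) (funits_map_subproof a).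

(* The union of the annihilators of the images of the non-zero pure symbols of k.
   (Left and right annihilators agree, as the ring is commutative.) *)
Definition isotropic_ideal : set (milnor F) :=
  [set x | exists2 s : seq (funits k),
     symbol s != 0 & symbol (map funits_map s) * x = 0].

(* When k is flexible and F is finitely generated over k, [isotropic_ideal] is
   itself an ideal, so this is the quotient by it and not by a larger ideal. *)
Definition isotropic_milnor : galg :=
  @GAlg (qalg isotropic_ideal)
    (fun n => [set api isotropic_ideal x | x in @milnor_deg F n]).

End IsotropicMilnor.

Section Flexible.
Import mpoly.

(* [k] is generated as a field by [k0] and a sequence [t] that is algebraically
   independent over [k0].  (Purely transcendental extensions of uncountable degree
   are covered, by moving all but countably many variables into [k0].) *)
Definition flexible (k : fieldType) : Prop :=
  exists (k0 : fieldType) (i : {rmorphism k0 -> k}) (t : nat -> k),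
    let ev n (p : mpoly n k0) := mmap i (fun j : 'I_n => t j) p in
    (forall n (p : mpoly n k0), ev n p = 0 -> p = 0) /\
    (forall x, exists n (p q : mpoly n k0), ev n q != 0 /\ x = ev n p / ev n q).

End Flexible.

(* Main.v *)
(** The nonzero elements [brk a] (the classes {a}) generate k_*(F), and the theorem
    amounts to two facts about a finite extension F of odd degree of a flexible k:
    the map k_*(k) -> k_*(F) is injective, and every {a} with a in F^* is a sum of
    elements killed by nonzero pure symbols of k.  The first gives an augmentation on the
    quotient: if s (1 + y) = 0 with y of positive degree, then s = 0 in k_*(F) by
    comparing degrees.

    Injectivity: by induction on the degree we may take F = k[X]/P with P of odd
    degree m.  If z vanishes in k_*(F), then {P} z is a combination of symbols of
    polynomials of degree < m (Bass-Tate, Milnor), hence constant since its residues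
    at finite places of degree < m vanish; but its residue at infinity is m z = z.

    Killing: pick w_1, ..., w_m in F whose squares form a k-basis of F (this uses
    char k <> 2), and independent variables u_l of k not involved in the matrix of
    the multiplication by a in this basis.  With x = sum_l u_l w_l^2, the Pfister form
    <<-u_1, ..., -u_m>> represents x, so the symbol {-u_1, ..., -u_m} kills {x}.  Now
    a x = sum_l v_l w_l^2, where the v_l are linearly independent linear forms in the
    u_l, so {-v_1, ..., -v_m} kills {a x}.  Both symbols are nonzero by taking iterated
    residues, and {a} = {a x} + {x}. *)
Require Import Defs.
From HB Require Import structures.
From mathcomp Require Import all_boot all_order all_algebra all_field.
From mathcomp Require Import boolp classical_sets monalg generic_quotient.
From mathcomp Require mpoly.

Set Implicit Arguments.
Unset Strict Implicit.
Unset Printing Implicit Defensive.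

Import GRing.Theory.
Local Open Scope AC_scope.
Local Open Scope classical_set_scope.
Local Open Scope ring_scope.

(** * Milnor K-theory modulo 2 *)

Lemma api0 (A : f2algType) (S : set A) : api S 0 = 0.
Proof. by apply: (@addrI _ (api S 0)); rewrite -apiD !addr0. Qed.

Lemma api_sum (A : f2algType) (S : set A) I (r : seq I) (f : I -> A) :
  api S (\sum_(i <- r) f i) = \sum_(i <- r) api S (f i).
Proof. exact: (big_morph _ (@apiD _ _) (api0 _)). Qed.

Lemma api_eq0 (A : f2algType) (S : set A) x : api S x = 0 <-> ideal_gen S x.
Proof. by rewrite -(api0 S) apiP subr0. Qed.

(** * Maps out of free algebras and their quotients *)

Section FreeExtension.
Variables (X : choiceType) (A : f2algType) (f : X -> A).

Definition free_ext (x : free_alg X) : A :=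
  @flin {fmonom X} (vec A) (fun m => \prod_(a <- (m : seq X)) f a) x.

Lemma free_extD : {morph free_ext : x y / x + y}.
Proof. exact: (raddfD (@flin {fmonom X} (vec A) _)). Qed.

Lemma free_ext0 : free_ext 0 = 0.
Proof. exact: (raddf0 (@flin {fmonom X} (vec A) _)). Qed.

Lemma free_ext_word s : free_ext (fword s) = \prod_(a <- s) f a.
Proof. by rewrite /free_ext fword.unlock flinU. Qed.

Lemma free_ext1 : free_ext 1 = 1.
Proof. by rewrite -fword0 free_ext_word big_nil. Qed.

Lemma free_ext_sum I (r : seq I) (F : I -> free_alg X) :
  free_ext (\sum_(i <- r) F i) = \sum_(i <- r) free_ext (F i).
Proof. exact: (big_morph _ free_extD free_ext0). Qed.

Lemma free_extM : {morph free_ext : x y / x * y}.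
Proof.
move=> x y; have [s ->] := free_alg_words x; have [t ->] := free_alg_words y.
rewrite mulr_suml !free_ext_sum mulr_suml; apply: eq_bigr => v _.
rewrite mulr_sumr !free_ext_sum mulr_sumr; apply: eq_bigr => w _.
by rewrite -fword_cat !free_ext_word big_cat.
Qed.

Lemma free_extB : {morph free_ext : x y / x - y}.
Proof. exact: (raddfB (@flin {fmonom X} (vec A) _)). Qed.

End FreeExtension.

Lemma f2addrr (A : f2algType) (x : A) : x + x = 0.
Proof. exact: (@addrr2 A x). Qed.

Lemma f2oppr (A : f2algType) (x : A) : - x = x.
Proof. by apply/esym/eqP; rewrite -addr_eq0 f2addrr. Qed.

Lemma is_ideal_mk (A : f2algType) (U : set A) :
  U 0 -> (forall x y, U x -> U y -> U (x + y)) ->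
  (forall a x, U x -> U (a * x)) -> (forall a x, U x -> U (x * a)) ->
  is_ideal U.
Proof.
move=> U0 UD Ul Ur; split=> [|a x Ux]; last by split; [exact: Ul|exact: Ur].
split=> // c x y Ux Uy; have [->|->] := f2P c; last by rewrite scale1r; apply: UD.
by rewrite scale0r add0r.
Qed.

Section AlgebraQuotientExtension.
Variables (A B : f2algType) (S : set A) (g : A -> B).
Hypotheses (gD : {morph g : x y / x + y}) (gM : {morph g : x y / x * y}).
Hypotheses (g1 : g 1 = 1) (gS : forall x, S x -> g x = 0).

Lemma ideal_gen_ker x : ideal_gen S x -> g x = 0.
Proof.
have g0 : g 0 = 0 by apply: (@addrI _ (g 0)); rewrite -gD !addr0.
apply: (@ideal_gen_sub _ _ [set x | g x = 0]) => //.
apply: is_ideal_mk => [//|y z /= gy gz|a y /= gy|a y /= gy].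
- by rewrite gD gy gz addr0.
- by rewrite gM gy mulr0.
- by rewrite gM gy mul0r.
Qed.

(** The morphism is [g] on a chosen representative, well defined because [g] kills the ideal
    generated by [S]. The hypotheses bear on a bare function, so that unbundled maps such as
    [free_ext] are accepted. *)
Lemma qalg_rec : exists h : {rmorphism qalg S -> B}, forall x, h (api S x) = g x.
Proof.
have g0 : g 0 = 0 by apply: (@addrI _ (g 0)); rewrite -gD !addr0.
have gN x : g (- x) = - g x by apply/eqP; rewrite -addr_eq0 -gD addNr g0.
pose h (x : qalg S) := g (arepr S x).
have hE x : h (api S x) = g x.
  apply/eqP; rewrite -subr_eq0 -gN -gD; apply/eqP/ideal_gen_ker.
  by apply/apiP; rewrite areprK.
have hB : {morph h : x y / x - y}.
  move=> x y; rewrite -[x](areprK) -[y]areprK -(raddfB (qpi _)) /= !hE.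
  by rewrite gD gN.
have hM : monoid_morphism h.
  split=> [|x y]; first by rewrite -api1 hE.
  by rewrite -[x](areprK) -[y]areprK -apiM !hE gM.
pose mA := GRing.isZmodMorphism.Build _ _ h hB.
pose mM := GRing.isMonoidMorphism.Build _ _ h hM.
pose H : {rmorphism qalg S -> B} := HB.pack_for {rmorphism qalg S -> B} h mA mM.
by exists H.
Qed.

End AlgebraQuotientExtension.

(** * Generators and relations of k_*(F) *)

Section MilnorSymbols.
Variable F : fieldType.
Implicit Types a b : F.

(* The class {a}, extended by the junk value 0 at a = 0. *)
Definition brk a : milnor F :=
  oapp (fun u : funits F => symbol [:: u]) 0 (insub a : option {a : F | a != 0}).

Lemma brk0 : brk 0 = 0.
Proof. by rewrite /brk insubF ?eqxx. Qed.

Lemma brk_val (u : funits F) : brk (val u) = symbol [:: u].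
Proof. by rewrite /brk (valK (u : {a : F | a != 0})). Qed.

Lemma brk_unit a : a != 0 -> exists u : funits F, val u = a /\ brk a = symbol [:: u].
Proof. by move=> a0; exists (exist _ a a0); rewrite -brk_val. Qed.

Lemma symbolE (s : seq (funits F)) : symbol s = \prod_(u <- s) brk (val u).
Proof.
elim: s => [|u s IH]; first by rewrite big_nil /symbol fword0 api1.
by rewrite big_cons -IH brk_val /symbol -apiM -fword_cat.
Qed.

Lemma symbol_cat (s t : seq (funits F)) : symbol (s ++ t) = symbol s * symbol t.
Proof. by rewrite !symbolE big_cat. Qed.

Lemma symbol_cons u (s : seq (funits F)) : symbol (u :: s) = brk (val u) * symbol s.
Proof. by rewrite !symbolE big_cons. Qed.

Lemma symbol_nil : symbol [::] = 1 :> milnor F.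
Proof. by rewrite symbolE big_nil. Qed.

Lemma brkM a b : a != 0 -> b != 0 -> brk (a * b) = brk a + brk b.
Proof.
move=> a0 b0; have ab0 : a * b != 0 by rewrite mulf_neq0.
have [u [ua ->]] := brk_unit a0; have [v [vb ->]] := brk_unit b0.
have [w [wab ->]] := brk_unit ab0.
rewrite /symbol -apiD; apply/apiP; apply: sub_ideal_gen; left; exists u, v, w.
by rewrite ua vb wab opprD addrA.
Qed.

Lemma brk_steinberg a b : a + b = 1 -> brk a * brk b = 0.
Proof.
have [->|a0] := eqVneq a 0; first by rewrite brk0 mul0r.
have [->|b0] := eqVneq b 0; first by rewrite brk0 mulr0.
have [u [<- ->]] := brk_unit a0; have [v [<- ->]] := brk_unit b0 => uv.
rewrite -symbol_cat; apply/api_eq0; apply: sub_ideal_gen; right.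
by exists u, v.
Qed.

(** Products of classes {a} span k_*(F), and each product is built from 1 by adding letters on the
    left. *)
Lemma milnor_ind (P : milnor F -> Prop) :
  P 0 -> P 1 -> (forall x y, P x -> P y -> P (x + y)) ->
  (forall a x, a != 0 -> P x -> P (brk a * x)) -> forall x, P x.
Proof.
move=> P0 P1 PD PM x; rewrite -[x]areprK.
have [s ->] := free_alg_words (arepr _ x).
rewrite api_sum; elim: s => [|w s IH]; first by rewrite big_nil.
rewrite big_cons; apply: PD => //; elim: w => [|u w IHw]; first by rewrite fword0 api1.
by rewrite -[api _ _]/(symbol (u :: w)) symbol_cons; apply: PM => //; exact: (valP u).
Qed.

(** The universal property of the presentation; functoriality, augmentation and residues are all
    obtained from it. *)
Lemma milnor_rec (B : f2algType) (f : F -> B) :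
  (forall a b, a != 0 -> b != 0 -> f (a * b) = f a + f b) ->
  (forall a b, a != 0 -> b != 0 -> a + b = 1 -> f a * f b = 0) ->
  exists h : {rmorphism milnor F -> B}, forall a, a != 0 -> h (brk a) = f a.
Proof.
move=> fM fS; pose g := free_ext (fun u : funits F => f (val u)).
have [||||h hE] := @qalg_rec _ B (milnor_rel (F := F)) g.
- exact: free_extD.
- exact: free_extM.
- exact: free_ext1.
- move=> x [[a [b [c [cab ->]]]]|[a [b [ab ->]]]].
    rewrite /g !free_extB !free_ext_word !big_seq1 cab fM ?(valP a) ?(valP b) //.
    by rewrite [X in X - _ - _]addrC addrK subrr.
  by rewrite /g free_ext_word !big_cons big_nil mulr1 fS ?(valP a) ?(valP b).
exists h => a a0; have [u [ua ->]] := brk_unit a0.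
by rewrite /symbol hE /g free_ext_word big_seq1 ua.
Qed.

Lemma brk1 : brk 1 = 0.
Proof.
by apply: (@addrI _ (brk 1)); rewrite addr0 -brkM ?oner_neq0 // mulr1.
Qed.

Lemma brkV a : brk a^-1 = brk a.
Proof.
have [->|a0] := eqVneq a 0; first by rewrite invr0.
apply: (@addrI _ (brk a)); rewrite f2addrr -brkM ?invr_eq0 // mulfV // brk1 //.
Qed.

Lemma brk_div a b : a != 0 -> b != 0 -> brk (a / b) = brk a + brk b.
Proof. by move=> a0 b0; rewrite brkM ?invr_eq0 // brkV. Qed.

Lemma brkMsqr a b : b != 0 -> brk (a * b ^+ 2) = brk a.
Proof.
have [->|a0 b0] := eqVneq a 0; first by rewrite mul0r.
by rewrite brkM ?expf_neq0 // expr2 brkM // f2addrr addr0.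
Qed.

Lemma brkN a : a != 0 -> brk (- a) = brk a + brk (-1).
Proof. by move=> a0; rewrite -[in LHS](mulr1 a) -mulrN brkM ?oppr_eq0 ?oner_neq0. Qed.

(* As [- a = (1 - a) / (1 - a^-1)], the Steinberg relations for [a] and for
   [a^-1] give the claim. *)
Lemma brk_mulN a : brk a * brk (- a) = 0.
Proof.
have [->|a0] := eqVneq a 0; first by rewrite brk0 mul0r.
have [->|a1] := eqVneq a 1; first by rewrite brk1 mul0r.
have b0 : 1 - a != 0 by rewrite subr_eq0 eq_sym.
have c0 : 1 - a^-1 != 0.
  by rewrite subr_eq0 eq_sym; apply: contraNneq a1 => h; rewrite -[a]invrK h invr1.
have -> : - a = (1 - a) / (1 - a^-1).
  apply: (mulIf c0); rewrite divfK // mulrBr mulr1 mulNr mulfV //.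
  by rewrite opprK addrC.
rewrite brk_div // mulrDr brk_steinberg; last by rewrite addrC subrK.
by rewrite add0r -brkV brk_steinberg // addrC subrK.
Qed.

Lemma brk_sqr a : brk a * brk a = brk a * brk (-1).
Proof.
have [->|a0] := eqVneq a 0; first by rewrite brk0 !mul0r.
by have := brk_mulN a; rewrite brkN // mulrDr => /eqP; rewrite addr_eq0 f2oppr => /eqP.
Qed.

(** Expand {ab}{-ab} = 0 with {-ab} = {a} + {b} + {-1}: the squares {a}^2 = {a}{-1} and {b}^2 =
    {b}{-1} cancel, leaving {a}{b} + {b}{a} = 0. *)
Lemma brk_comm a b : brk a * brk b = brk b * brk a.
Proof.
have [->|a0] := eqVneq a 0; first by rewrite brk0 mul0r mulr0.
have [->|b0] := eqVneq b 0; first by rewrite brk0 mul0r mulr0.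
have := brk_mulN (a * b); rewrite -mulrN.
rewrite brkM // (brkM (a := a)) ?oppr_eq0 // (brkN b0) !mulrDl !mulrDr.
rewrite brk_sqr [brk b * brk b]brk_sqr.
set x := brk a * _; set y := _ * brk b; set z := brk b * _; set t := brk b * _.
by rewrite (f2addrr t) addr0 addrCA f2addrr addr0 => /eqP; rewrite addr_eq0 f2oppr => /eqP.
Qed.

Lemma milnorC (x y : milnor F) : x * y = y * x.
Proof.
elim/milnor_ind: x y => [y|y|x x' IH IH' y|a x a0 IH y].
- by rewrite mul0r mulr0.
- by rewrite mul1r mulr1.
- by rewrite mulrDl mulrDr IH IH'.
rewrite -mulrA IH; suff -> : forall y, y * (brk a * x) = brk a * (y * x) by [].
elim/milnor_ind => [|| z z' IHz IHz'|b z b0 IHz].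
- by rewrite !(mul0r, mulr0).
- by rewrite !mul1r.
- by rewrite !(mulrDl, mulrDr) IHz IHz'.
- by rewrite -!mulrA IHz !mulrA brk_comm.
Qed.

End MilnorSymbols.

Lemma milnor_hom_eq (F : fieldType) (B : f2algType) (h h' : {rmorphism milnor F -> B}) :
  (forall a, a != 0 -> h (brk a) = h' (brk a)) -> h =1 h'.
Proof.
move=> hh'; elim/milnor_ind => [||x y hx hy|a x a0 hx].
- by rewrite !rmorph0.
- by rewrite !rmorph1.
- by rewrite !rmorphD hx hy.
- by rewrite !rmorphM hh' // hx.
Qed.

Section MilnorMap.
Variables (k F : fieldType) (i : {rmorphism k -> F}).

Lemma milnor_map_ex :
  exists h : {rmorphism milnor k -> milnor F}, forall a, a != 0 -> h (brk a) = brk (i a).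
Proof.
apply: (milnor_rec (f := fun a => brk (i a))) => a b a0 b0.
  by rewrite rmorphM brkM ?fmorph_eq0.
by move=> ab; rewrite brk_steinberg // -rmorphD ab rmorph1.
Qed.

Definition milnor_map : {rmorphism milnor k -> milnor F} := projT1 (cid milnor_map_ex).

Lemma milnor_map_brk a : milnor_map (brk a) = brk (i a).
Proof.
have [->|a0] := eqVneq a 0; first by rewrite rmorph0 !brk0 rmorph0.
by rewrite /milnor_map; case: cid => h /= ->.
Qed.

Lemma milnor_map_symbol s : milnor_map (symbol s) = symbol (map (funits_map i) s).
Proof.
elim: s => [|u s IH]; first by rewrite !symbol_nil rmorph1.
by rewrite /= !symbol_cons rmorphM milnor_map_brk IH.
Qed.

End MilnorMap.

Lemma milnor_map_comp (k E F : fieldType) (i : {rmorphism k -> E}) (j : {rmorphism E -> F})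
    (h : {rmorphism k -> F}) : (forall a, h a = j (i a)) ->
  forall x, milnor_map h x = milnor_map j (milnor_map i x).
Proof.
move=> hE; apply: (@milnor_hom_eq _ _ (milnor_map h) (milnor_map j \o milnor_map i)).
by move=> a a0; rewrite /= !milnor_map_brk hE.
Qed.

Lemma milnor_map_id (F : fieldType) (i : {rmorphism F -> F}) : (forall a, i a = a) ->
  forall x, milnor_map i x = x.
Proof.
move=> iE; apply: (@milnor_hom_eq _ _ (milnor_map i) idfun) => a _ /=.
by rewrite milnor_map_brk iE.
Qed.

(** * Augmentation and word length *)

Lemma milnor_aug_ex (F : fieldType) :
  exists h : {rmorphism milnor F -> F2}, forall a, a != 0 -> h (brk a) = 0.
Proof. by apply: (milnor_rec (f := fun=> 0)) => *; rewrite ?addr0 ?mulr0. Qed.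

Definition milnor_aug (F : fieldType) : {rmorphism milnor F -> F2} :=
  projT1 (cid (milnor_aug_ex F)).

Lemma milnor_aug_brk (F : fieldType) a : milnor_aug F (brk a) = 0.
Proof.
have [->|a0] := eqVneq a 0; first by rewrite brk0 rmorph0.
by rewrite /milnor_aug; case: cid => h /= ->.
Qed.

Lemma milnor_aug_symbol (F : fieldType) (s : seq (funits F)) :
  milnor_aug F (symbol s) = (nilp s)%:R.
Proof.
case: s => [|u s]; first by rewrite symbol_nil rmorph1.
by rewrite symbol_cons rmorphM milnor_aug_brk mul0r.
Qed.

Lemma natr_char2 (A : f2algType) n : n%:R = (odd n)%:R :> A.
Proof.
rewrite -[in LHS](odd_double_half n) natrD -muln2 natrM (char2 : 2%:R = 0 :> A).
by rewrite mulr0 addr0.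
Qed.

Section WordLength.
Variable X : choiceType.

Definition length_comp (n : nat) (x : free_alg X) : free_alg X :=
  @flin {fmonom X} (vec (free_alg X))
    (fun m => if size (m : seq X) == n then fword m else 0) x.

Lemma length_comp_sum n I (r : seq I) (f : I -> free_alg X) :
  length_comp n (\sum_(i <- r) f i) = \sum_(i <- r) length_comp n (f i).
Proof. exact: (raddf_sum (@flin {fmonom X} (vec (free_alg X)) _)). Qed.

Lemma length_compD n : {morph length_comp n : x y / x + y}.
Proof. exact: (raddfD (@flin {fmonom X} (vec (free_alg X)) _)). Qed.

Lemma length_compB n : {morph length_comp n : x y / x - y}.
Proof. exact: (raddfB (@flin {fmonom X} (vec (free_alg X)) _)). Qed.

Lemma length_comp_word n s :
  length_comp n (fword s) = if size s == n then fword s else 0.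
Proof. by rewrite /length_comp fword.unlock flinU. Qed.

Lemma length_comp_mull n w x : length_comp n (fword w * x) =
  if (size w <= n)%N then fword w * length_comp (n - size w)%N x else 0.
Proof.
have [s ->] := free_alg_words x.
rewrite mulr_sumr !length_comp_sum; case: leqP => h.
  rewrite mulr_sumr; apply: eq_bigr => v _.
  rewrite -fword_cat !length_comp_word size_cat -{1}(subnKC h) eqn_add2l.
  by case: eqP => _; rewrite ?fword_cat ?mulr0.
rewrite big1 // => v _; rewrite -fword_cat length_comp_word size_cat.
by case: eqP => // e; move: h; rewrite -e ltnNge leq_addr.
Qed.

Lemma length_comp_mulr n w x : length_comp n (x * fword w) =
  if (size w <= n)%N then length_comp (n - size w)%N x * fword w else 0.
Proof.
have [s ->] := free_alg_words x.
rewrite mulr_suml !length_comp_sum; case: leqP => h.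
  rewrite mulr_suml; apply: eq_bigr => v _.
  rewrite -fword_cat !length_comp_word size_cat -{1}(subnK h) eqn_add2r.
  by case: eqP => _; rewrite ?fword_cat ?mul0r.
rewrite big1 // => v _; rewrite -fword_cat length_comp_word size_cat.
by case: eqP => // e; move: h; rewrite -e ltnNge leq_addl.
Qed.

(** Multiplication by a word only shifts lengths, so the elements all of whose components lie in the
    ideal form an ideal containing [S]. Hence the ideal is homogeneous. *)
Lemma ideal_gen_comp (S : set (free_alg X)) n x :
  (forall y m, S y -> ideal_gen S (length_comp m y)) ->
  ideal_gen S x -> ideal_gen S (length_comp n x).
Proof.
move=> SS; have [SI SM] := ideal_gen_is_ideal S; have [S0 SD] := SI.
have SA (y z : free_alg X) : ideal_gen S y -> ideal_gen S z -> ideal_gen S (y + z).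
  by move=> Sy Sz; have := SD 1 y z Sy Sz; rewrite scale1r.
have Ssum (r : seq (seq X)) f : (forall w, ideal_gen S (f w)) ->
    ideal_gen S (\sum_(w <- r) f w).
  by move=> Sf; elim/big_rec: _ => [|w y _ Sy]; [exact: S0|apply: SA].
move=> Sx; suff : [set y | forall m, ideal_gen S (length_comp m y)]%classic x by apply.
apply: (@ideal_gen_sub _ _ [set y | forall m, ideal_gen S (length_comp m y)]%classic) Sx;
  last by move=> y Sy m; exact: SS.
apply: is_ideal_mk => [m|y z Uy Uz m|a y Uy m|a y Uy m] /=.
- by rewrite -(subrr 0) length_compB subrr; exact: S0.
- by rewrite length_compD; apply: SA.
- have [s ->] := free_alg_words a; rewrite mulr_suml length_comp_sum.
  by apply: Ssum => w; rewrite length_comp_mull; case: ifP => _ //; apply: (SM _ _ _).1.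
- have [s ->] := free_alg_words a; rewrite mulr_sumr length_comp_sum.
  by apply: Ssum => w; rewrite length_comp_mulr; case: ifP => _ //; apply: (SM _ _ _).2.
Qed.

End WordLength.

(* An element of augmentation 1 is 1 plus an element of positive degree, so the
   lowest homogeneous component of [symbol s * x] is [symbol s]. *)
Lemma symbol_mul_aug1 (F : fieldType) (s : seq (funits F)) (x : milnor F) :
  milnor_aug F x = 1 -> symbol s * x = 0 -> symbol s = 0.
Proof.
rewrite -[x]areprK; have [r ->] := free_alg_words (arepr _ x) => x1.
rewrite /symbol -apiM => /api_eq0 sx; apply/api_eq0.
(* Each Milnor relation is homogeneous, of length 1 or 2. *)
have rel y m : milnor_rel y -> ideal_gen (milnor_rel (F := F)) (length_comp m y).
  move=> My; suff [->|->] : length_comp m y = y \/ length_comp m y = 0.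
  - exact: sub_ideal_gen.
  - by have [[]] := ideal_gen_is_ideal (milnor_rel (F := F)).
  case: My => [[a [b [c [_ ->]]]]|[a [b [_ ->]]]].
    rewrite !length_compB !length_comp_word /=.
    by case: eqP => _; [left|right; rewrite !subr0].
  by rewrite length_comp_word; case: eqP => _; [left|right].
have := ideal_gen_comp (size s) rel sx.
rewrite length_comp_mull leqnn subnn length_comp_sum.
(* The component of length 0 counts the empty words modulo 2, and this count is the augmentation of
   [x]. *)
suff -> : \sum_(w <- r) length_comp 0 (fword w) = 1 :> free_alg (funits F) by rewrite mulr1.
have -> : \sum_(w <- r) length_comp 0 (fword w) = (\sum_(w <- r) nilp w)%:R
    :> free_alg (funits F).
  rewrite natr_sum; apply: eq_bigr => w _; rewrite length_comp_word.
  by case: w => [|//]; rewrite fword0.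
rewrite natr_char2; move: x1; rewrite api_sum rmorph_sum /=.
under eq_bigr do rewrite milnor_aug_symbol.
by move=> h; have := natr_char2 F2 (\sum_(w <- r) nilp w); rewrite natr_sum h; case: odd.
Qed.

(** * Residues at discrete valuations *)

(* The ring k_*(K)[xi] / (xi^2 = {-1} xi), the pair (a, b) standing for a + b xi. *)
Definition tame (K : fieldType) : Type := (milnor K * milnor K)%type.

HB.instance Definition _ K := GRing.Zmodule.copy (tame K) (milnor K * milnor K)%type.

Section TameRing.
Variable K : fieldType.
Implicit Types x y z : tame K.

Definition tame_mul x y : tame K :=
  (x.1 * y.1, x.1 * y.2 + x.2 * y.1 + x.2 * y.2 * brk (-1)).
Definition tame_one : tame K := (1, 0).

Fact tame_mulA : associative tame_mul.
Proof.
case=> a b [c d] [e f]; rewrite /tame_mul /=; congr pair; first exact: mulrA.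
rewrite !mulrDr !mulrDl !mulrA !addrA.
have epsC u v : u * brk (-1) * v = u * v * brk (-1) :> milnor K.
  by rewrite -!mulrA (milnorC (brk (-1))).
rewrite (epsC (b * d) e) (epsC (b * d) f).
by rewrite [LHS](ACl (1*2*4*6*3*5*7)).
Qed.
Fact tame_mul1l : left_id tame_one tame_mul.
Proof. by case=> a b; rewrite /tame_mul /= !mul1r !mul0r !addr0. Qed.
Fact tame_mul1r : right_id tame_one tame_mul.
Proof. by case=> a b; rewrite /tame_mul /= !mulr1 !mulr0 mul0r add0r addr0. Qed.
Fact tame_mulDl : left_distributive tame_mul +%R.
Proof.
case=> a b [c d] [e f]; rewrite /tame_mul /=; congr pair; first exact: mulrDl.
by rewrite !mulrDl !addrA [LHS](ACl (1*3*5*2*4*6)).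
Qed.
Fact tame_mulDr : right_distributive tame_mul +%R.
Proof.
case=> a b [c d] [e f]; rewrite /tame_mul /=; congr pair; first exact: mulrDr.
by rewrite !mulrDr mulrDl !addrA [LHS](ACl (1*3*5*2*4*6)).
Qed.
HB.instance Definition _ := GRing.Zmodule_isPzRing.Build (tame K)
  tame_mulA tame_mul1l tame_mul1r tame_mulDl tame_mulDr.

Fact tame_char2 : 2%:R = 0 :> tame K.
Proof. by rewrite mulr2n; congr pair; rewrite /= f2addrr. Qed.
HB.instance Definition _ := hasChar2.Build (tame K) tame_char2.

Lemma tameM x y :
  x * y = (x.1 * y.1, x.1 * y.2 + x.2 * y.1 + x.2 * y.2 * brk (-1)).
Proof. by []. Qed.

Lemma tameD x y : x + y = (x.1 + y.1, x.2 + y.2). Proof. by []. Qed.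

Lemma tame0 : (0 : tame K) = (0, 0). Proof. by []. Qed.

End TameRing.

(* A discrete valuation on [k], of which only the parity [par] is kept, with the
   residue [res] of [x / pi ^ v x] for a fixed uniformizer [pi]. *)
Record place (k K : fieldType) := Place {
  par : k -> bool;
  res : k -> K;
  parM : forall x y, x != 0 -> y != 0 -> par (x * y) = par x (+) par y;
  resM : forall x y, x != 0 -> y != 0 -> res (x * y) = res x * res y;
  res_neq0 : forall x, x != 0 -> res x != 0;
  place_add : forall x y, x != 0 -> y != 0 -> x + y = 1 ->
    [\/ par x = false /\ res x = 1, par y = false /\ res y = 1,
        par x = par y /\ res x = - res y
      | [/\ par x = false, par y = false & res x + res y = 1]]
}.

Section Residue.
Variables (k K : fieldType) (P : place k K).

(** The first component is the specialization map and the second the tame symbol. The cases of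
    [place_add] are v(b) > 0, v(a) > 0, v(a) = v(b) < 0 and v(a) = v(b) = 0; in the third, {c}{-c} =
    0 and xi^2 = {-1} xi make the product vanish. *)
Lemma residue_ex : exists h : {rmorphism milnor k -> tame K},
  forall a, a != 0 -> h (brk a) = (brk (res P a), (par P a)%:R).
Proof.
apply: (milnor_rec (f := fun a => (brk (res P a), (par P a)%:R) : tame K)) => a b a0 b0.
  rewrite resM // parM // brkM ?res_neq0 // tameD /=; congr pair.
  by case: (par P a); case: (par P b); rewrite ?addr0 ?add0r ?f2addrr.
move=> /(place_add P a0 b0) [] /=; rewrite tameM tame0 /=.
- by case=> -> ->; rewrite brk1 !mul0r !addr0.
- by case=> -> ->; rewrite brk1 !mulr0 mul0r !addr0.
- case=> -> ->; have b0' := res_neq0 P b0.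
  rewrite milnorC brk_mulN brkN //; congr pair; case: (par P b) => /=.
    rewrite !mulr1 !mul1r -[X in X + _]addrA [_ + brk (res P b)]addrC addrA f2addrr add0r.
    by rewrite f2addrr.
  by rewrite !(mulr0, mul0r, addr0).
- by case=> -> -> h; rewrite !(mulr0, mul0r, addr0) brk_steinberg.
Qed.

Definition residue : {rmorphism milnor k -> tame K} := projT1 (cid residue_ex).

Lemma residue_brk a : a != 0 -> residue (brk a) = (brk (res P a), (par P a)%:R).
Proof. by rewrite /residue; case: cid => h /= hE /hE. Qed.

Lemma residue_const (L : fieldType) (i : {rmorphism L -> k}) (j : {rmorphism L -> K}) :
  (forall a, a != 0 -> par P (i a) = false /\ res P (i a) = j a) ->
  forall z, residue (milnor_map i z) = (milnor_map j z, 0).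
Proof.
move=> ij; elim/milnor_ind => [||x y hx hy|a x a0 hx].
- by rewrite !rmorph0.
- by rewrite !rmorph1.
- by rewrite !rmorphD hx hy tameD /= addr0.
rewrite !rmorphM hx !milnor_map_brk residue_brk ?fmorph_eq0 //.
have [-> ->] := ij a a0; rewrite tameM /=.
by rewrite mulr0 !mul0r !addr0.
Qed.

End Residue.

(** Fraction fields enter only through this property, so that a flexible field, written as K(t_N),
    can serve as well as [{fraction R}]. *)
Definition is_frac (R : nzRingType) (k : fieldType) (phi : {rmorphism R -> k}) :=
  injective phi /\ forall x, exists p q, q != 0 /\ x = phi p / phi q.

Lemma is_frac_eq0 (R : nzRingType) (k : fieldType) (phi : {rmorphism R -> k}) :
  is_frac phi -> forall p, (phi p == 0) = (p == 0).
Proof. by move=> [phi_inj _] p; rewrite -(inj_eq phi_inj) rmorph0. Qed.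

(** * Places of fraction fields *)

Section FractionPlace.
Variables (R : idomainType) (k K : fieldType) (phi : {rmorphism R -> k}).
Hypothesis phi_frac : is_frac phi.
Variables (par0 : R -> bool) (res0 : R -> K).
Hypothesis par0M : forall p q, p != 0 -> q != 0 -> par0 (p * q) = par0 p (+) par0 q.
Hypothesis res0M : forall p q, p != 0 -> q != 0 -> res0 (p * q) = res0 p * res0 q.
Hypothesis res0_neq0 : forall p, p != 0 -> res0 p != 0.
Hypothesis add0 : forall p q, p != 0 -> q != 0 -> p + q != 0 ->
  [\/ par0 p = par0 (p + q) /\ res0 p = res0 (p + q),
      par0 q = par0 (p + q) /\ res0 q = res0 (p + q),
      par0 p = par0 q /\ res0 p = - res0 q
    | [/\ par0 p = par0 (p + q), par0 q = par0 (p + q) & res0 p + res0 q = res0 (p + q)]].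

Let phi_eq0 := is_frac_eq0 phi_frac.

(** Parity and residue of a fraction are read off any numerator and denominator. The hypothesis
    [add0] is the homogeneous form of [place_add]: the equation x + y = 1 is applied after clearing
    denominators. *)
Lemma frac_place_ex : exists P : place k K,
  forall p, p != 0 -> par P (phi p) = par0 p /\ res P (phi p) = res0 p.
Proof.
have rep x : exists pq : R * R, pq.2 != 0 /\ x = phi pq.1 / phi pq.2.
  by have [p [q h]] := phi_frac.2 x; exists (p, q).
pose nu x := projT1 (cid (rep x)); pose num x := (nu x).1; pose den x := (nu x).2.
have den0 x : den x != 0 by rewrite /den /nu; case: cid => pq /= [].
have xE x : x = phi (num x) / phi (den x) by rewrite /num /den /nu; case: cid => pq /= [].
have num0 x : x != 0 -> num x != 0.
  by rewrite {1}(xE x) mulf_eq0 negb_or phi_eq0 => /andP[].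
pose pr x := par0 (num x) (+) par0 (den x); pose rs x := res0 (num x) / res0 (den x).
(* The values do not depend on the chosen fraction: cross-multiply and use multiplicativity. *)
have prrsE p q : p != 0 -> q != 0 ->
    pr (phi p / phi q) = par0 p (+) par0 q /\ rs (phi p / phi q) = res0 p / res0 q.
  move=> p0 q0; set x := _ / _.
  have x0 : x != 0 by rewrite mulf_neq0 ?invr_eq0 ?phi_eq0.
  have e : p * den x = num x * q.
    apply: phi_frac.1; rewrite !rmorphM.
    have := xE x; rewrite {1}/x => /eqP.
    by rewrite eqr_div ?phi_eq0 // => /eqP.
  have := par0M p0 (den0 x); have := res0M p0 (den0 x).
  rewrite e par0M ?num0 // res0M ?num0 // => er ep; split.
    rewrite /pr; move: ep.
    by case: (par0 p); case: (par0 q); case: (par0 (num x)); case: (par0 (den x)).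
  apply/eqP; rewrite /rs eqr_div ?res0_neq0 //; exact/eqP.
have par01 : par0 1 = false by have := par0M (oner_neq0 R) (oner_neq0 R); rewrite mulr1; case: par0.
have res01 : res0 1 = 1.
  have := res0M (oner_neq0 R) (oner_neq0 R); rewrite mulr1 -{1}[res0 1]mulr1.
  by move/(mulfI (res0_neq0 (oner_neq0 R))).
have prrs1 p : p != 0 -> pr (phi p) = par0 p /\ rs (phi p) = res0 p.
  move=> p0; have := prrsE p 1 p0 (oner_neq0 R).
  by rewrite rmorph1 par01 res01 !divr1 addbF.
have MM x y : x != 0 -> y != 0 -> pr (x * y) = pr x (+) pr y /\ rs (x * y) = rs x * rs y.
  move=> /num0 x0 /num0 y0.
  have -> : x * y = phi (num x * num y) / phi (den x * den y).
    by rewrite {1}(xE x) {1}(xE y) mulf_div -!rmorphM.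
  have [||-> ->] := prrsE (num x * num y) (den x * den y); rewrite ?mulf_neq0 //.
  rewrite !par0M ?res0M // /pr /rs mulf_div; split=> //.
  by case: (par0 (num x)); case: (par0 (den x)); case: (par0 (num y)); case: (par0 (den y)).
have R0 x : x != 0 -> rs x != 0.
  by move=> /num0 x0; rewrite mulf_neq0 ?invr_eq0 ?res0_neq0.
have AA x y : x != 0 -> y != 0 -> x + y = 1 ->
    [\/ pr x = false /\ rs x = 1, pr y = false /\ rs y = 1,
        pr x = pr y /\ rs x = - rs y
      | [/\ pr x = false, pr y = false & rs x + rs y = 1]].
  move=> x0 y0 xy1.
  pose p := num x * den y; pose q := num y * den x; pose s := den x * den y.
  have s0 : s != 0 by rewrite mulf_neq0.
  have p0 : p != 0 by rewrite mulf_neq0 ?num0.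
  have q0 : q != 0 by rewrite mulf_neq0 ?num0.
  have xps : x = phi p / phi s.
    by rewrite {1}(xE x) /p /s !rmorphM -mulf_div divff ?mulr1 ?phi_eq0.
  have yqs : y = phi q / phi s.
    by rewrite {1}(xE y) /q /s [den x * _]mulrC !rmorphM -mulf_div divff ?mulr1 ?phi_eq0.
  have pqs : p + q = s.
    apply: phi_frac.1; rewrite rmorphD; apply: (mulIf (x := (phi s)^-1)).
      by rewrite invr_eq0 phi_eq0.
    by rewrite mulrDl -xps -yqs xy1 divff ?phi_eq0.
  have [px rx] := prrsE p s p0 s0; have [py ry] := prrsE q s q0 s0.
  rewrite -xps in px rx; rewrite -yqs in py ry; rewrite px rx py ry.
  have r0 := res0_neq0 s0.
  have := add0 p0 q0; rewrite pqs => /(_ s0) [[-> ->]|[-> ->]|[-> ->]|[-> -> e]].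
  - by apply: Or41; rewrite addbb divff.
  - by apply: Or42; rewrite addbb divff.
  - by apply: Or43; rewrite mulNr.
  - apply: Or44; rewrite addbb; split=> //.
    by rewrite -mulrDl e divff.
exists (@Place k K pr rs (fun x y x0 y0 => (MM x y x0 y0).1)
  (fun x y x0 y0 => (MM x y x0 y0).2) R0 AA).
by move=> p p0; exact: prrs1.
Qed.

End FractionPlace.

Section PolynomialPlaces.
Variables (K k : fieldType) (phi : {rmorphism {poly K} -> k}).
Hypothesis phi_frac : is_frac phi.

(** The valuation is minus the degree and the uniformizer is 1/X, so the residue of p / X^(deg p) is
    the leading coefficient. *)
Lemma infinite_place_ex : exists P : place k K, forall p, p != 0 ->
  par P (phi p) = odd (size p).-1 /\ res P (phi p) = lead_coef p.
Proof.
apply: (frac_place_ex phi_frac (par0 := fun p => odd (size p).-1))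
  => [p q p0 q0|p q _ _|p p0|p q p0 q0 s0].
- rewrite size_mul // -oddD; congr odd.
  move: p0 q0; rewrite -!size_poly_gt0; case: size => // m _.
  by case: size => // n _; rewrite addnS.
- exact: lead_coefM.
- by rewrite lead_coef_eq0.
have [lt|lt|e] := ltngtP (size p) (size q).
- by apply: Or42; rewrite addrC size_polyDl // lead_coefDl.
- by apply: Or41; rewrite size_polyDl // lead_coefDl.
have le : (size (p + q)%R <= size p)%N by rewrite (leq_trans (size_polyD _ _)) // e maxnn.
have cE : (p + q)`_(size p).-1 = lead_coef p + lead_coef q.
  by rewrite coefD /lead_coef e.
have [es|ns] := eqVneq (size (p + q)) (size p).
  by apply: Or44; rewrite es e; split=> //; rewrite -cE /lead_coef es.
apply: Or43; rewrite e; split=> //; apply/eqP; rewrite -addr_eq0 -cE.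
rewrite nth_default // -ltnS prednK ?size_poly_gt0 //.
by rewrite ltn_neqAle ns.
Qed.

Variables (L : fieldType) (ev : {rmorphism {poly K} -> L}) (Q : {poly K}).
Hypotheses (Q_irr : irreducible_poly Q) (evQ : ev Q = 0).

(** If [Q] did not divide [p], a Bezout relation between them would be mapped by [ev] to 0 = 1. *)
Lemma ev_eq0 p : (ev p == 0) = (Q %| p).
Proof.
apply/idP/idP => [/eqP p0|/dvdpP[q ->]]; last by rewrite rmorphM evQ mulr0.
have [/eqP|c1] := eqVneq (size (gcdp Q p)) 1%N.
  rewrite -coprimep_def => /Bezout_eq1_coprimepP[[u v] /= /(congr1 ev)].
  by rewrite rmorphD !rmorphM evQ p0 !mulr0 addr0 rmorph1 => /esym/eqP; rewrite oner_eq0.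
by rewrite -(eqp_dvdl _ (Q_irr.2 _ c1 (dvdp_gcdl _ _))) dvdp_gcdr.
Qed.

Let Q0 : Q != 0 := irredp_neq0 Q_irr.

Lemma mult_ex p : p != 0 -> exists nq : nat * {poly K}, p = Q ^+ nq.1 * nq.2 /\ ev nq.2 != 0.
Proof.
have [n] := ubnP (size p); elim: n p => // n IH p; rewrite ltnS => sp p0.
have [/dvdpP[q pE]|ndvd] := boolP (Q %| p); last first.
  by exists (0%N, p); rewrite expr0 mul1r ev_eq0.
have q0 : q != 0 by apply: contraNneq p0 => q0; rewrite pE q0 mul0r.
have [|//|[m r] [/= qE r0]] := IH q.
  rewrite (leq_trans _ sp) // pE size_mul // -subn1 -addnBA ?size_poly_gt0 //.
  by rewrite -[X in (X < _)%N]addn0 ltn_add2l subn_gt0 (Q_irr.1).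
by exists (m.+1, r); rewrite pE qE exprS mulrC -mulrA /=.
Qed.

Lemma mult_uniq m n q r : ev q != 0 -> ev r != 0 -> Q ^+ m * q = Q ^+ n * r ->
  m = n /\ q = r.
Proof.
wlog le : m n q r / (m <= n)%N.
  move=> h q0 r0 e; case/orP: (leq_total m n) => le; first exact: h.
  by have [] := h _ _ _ _ le r0 q0 (esym e).
move=> q0 r0; rewrite -(subnKC le) exprD -mulrA => /(mulfI (expf_neq0 m Q0)).
case: (n - m)%N => [|d] e; first by rewrite addn0 e expr0 mul1r.
by move: q0; rewrite e rmorphM rmorphXn evQ expr0n mul0r eqxx.
Qed.

(** The Q-adic place with uniformizer [Q]: write p = Q^m r with [ev r] nonzero, keep the parity of m
    and the residue [ev r]. *)
Lemma finite_place_ex : exists P : place k L,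
  (forall p, ev p != 0 -> par P (phi p) = false /\ res P (phi p) = ev p) /\
  (par P (phi Q) = true /\ res P (phi Q) = 1).
Proof.
have dec p : exists nq : nat * {poly K}, p != 0 -> p = Q ^+ nq.1 * nq.2 /\ ev nq.2 != 0.
  by have [->|/mult_ex[nq h]] := eqVneq p 0; [exists (0%N, 0)|exists nq].
pose mt p := (projT1 (cid (dec p))).1; pose cf p := (projT1 (cid (dec p))).2.
have pE p : p != 0 -> p = Q ^+ mt p * cf p by rewrite /mt /cf; case: cid => nq h /= /h[].
have cf0 p : p != 0 -> ev (cf p) != 0 by rewrite /cf; case: cid => nq h /= /h[].
have mtE n q : ev q != 0 -> mt (Q ^+ n * q) = n /\ cf (Q ^+ n * q) = q.
  move=> q0; have p0 : Q ^+ n * q != 0.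
    by rewrite mulf_neq0 ?expf_neq0 //; apply: contraNneq q0 => ->; rewrite rmorph0.
  by have [? ?] := mult_uniq q0 (cf0 _ p0) (pE _ p0); split; apply: esym.
have mulE p q : p != 0 -> q != 0 ->
    mt (p * q) = (mt p + mt q)%N /\ cf (p * q) = cf p * cf q.
  move=> p0 q0; have -> : p * q = Q ^+ (mt p + mt q) * (cf p * cf q).
    by rewrite {1}(pE p p0) {1}(pE q q0) mulrACA -exprD.
  by apply: mtE; rewrite rmorphM mulf_neq0 ?cf0.
have := frac_place_ex phi_frac (par0 := fun p => odd (mt p)) (res0 := fun p => ev (cf p)).
case=> [p q p0 q0|p q p0 q0|p p0|p q p0 q0 s0|P PE].
- by rewrite (mulE p q p0 q0).1 oddD.
- by rewrite (mulE p q p0 q0).2 rmorphM.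
- exact: cf0.
- wlog le : p q p0 q0 s0 / (mt p <= mt q)%N.
    move=> h; case/orP: (leq_total (mt p) (mt q)) => le; first exact: h.
    have := h q p q0 p0; rewrite [q + p]addrC => /(_ s0 le).
    case=> [[? ?]|[? ?]|[? ?]|[? ? ?]].
    + exact: Or42.
    + exact: Or41.
    + by apply: Or43; split=> //; apply/eqP; rewrite eq_sym eqr_oppLR; apply/eqP.
    + by apply: Or44; split=> //; rewrite addrC.
  have sE : p + q = Q ^+ mt p * (cf p + Q ^+ (mt q - mt p) * cf q).
    by rewrite mulrDr mulrA -exprD subnKC // -!pE.
  (* With distinct multiplicities the smaller one dominates the sum; with equal ones the reductions
     either cancel or add up. *)
  move: le; rewrite leq_eqVlt => /orP[/eqP e|lt]; last first.
    have r0 : ev (Q ^+ (mt q - mt p) * cf q) = 0.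
      by rewrite rmorphM rmorphXn evQ expr0n subn_eq0 leqNgt lt mul0r.
    have [|em ec] := mtE (mt p) (cf p + Q ^+ (mt q - mt p) * cf q).
      by rewrite rmorphD r0 addr0 cf0.
    by apply: Or41; rewrite sE em ec rmorphD r0 addr0.
  move: sE; rewrite e subnn expr0 mul1r => sE.
  have [r0|r0] := eqVneq (ev (cf p + cf q)) 0.
    by apply: Or43; split=> //; apply/eqP; rewrite -addr_eq0 -rmorphD r0.
  have [em ec] := mtE (mt q) _ r0.
  by apply: Or44; rewrite sE em ec rmorphD.
exists P; split=> [p p0|].
  have p0' : p != 0 by apply: contraNneq p0 => ->; rewrite rmorph0.
  have [-> ->] := PE p p0'; have [] := mtE 0%N p p0.
  by rewrite expr0 mul1r => -> ->.
have [-> ->] := PE Q Q0; have [] := mtE 1%N 1; first by rewrite rmorph1 oner_neq0.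
by rewrite expr1 mulr1 => -> ->; rewrite rmorph1.
Qed.

End PolynomialPlaces.

(** * The filtration of k_*(k(X)) by degree *)

Section LowDegree.
Variables (k FX : fieldType) (phi : {rmorphism {poly k} -> FX}).
Hypothesis phi_frac : is_frac phi.

Let phi_eq0 := is_frac_eq0 phi_frac.

Let cst : {rmorphism k -> FX} := phi \o polyC.

(* Milnor's filtration of k_*(k(X)); sizes are degrees plus one. *)
Inductive low (n : nat) : milnor FX -> Prop :=
| low0 : low n 0
| low1 : low n 1
| lowD y z : low n y -> low n z -> low n (y + z)
| lowMp (p : {poly k}) y : p != 0 -> (size p <= n)%N -> low n y -> low n (brk (phi p) * y).

Lemma lowM n y z : low n y -> low n z -> low n (y * z).
Proof.
move=> ly lz; elim: ly => [||u v _ IHu _ IHv|p u p0 sp _ IH].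
- by rewrite mul0r; exact: low0.
- by rewrite mul1r.
- by rewrite mulrDl; exact: lowD.
- by rewrite -mulrA; exact: lowMp.
Qed.

Lemma low_brk n (p : {poly k}) : (size p <= n)%N -> low n (brk (phi p)).
Proof.
have [->|p0] := eqVneq p 0; first by rewrite rmorph0 brk0 => _; exact: low0.
by move=> sp; rewrite -[brk _]mulr1; apply: lowMp => //; exact: low1.
Qed.

Lemma low_le m n y : (m <= n)%N -> low m y -> low n y.
Proof.
move=> mn; elim=> [||u v _ IHu _ IHv|p u p0 sp _ IH].
- exact: low0.
- exact: low1.
- exact: lowD.
- by apply: lowMp => //; exact: leq_trans mn.
Qed.

Lemma low_sum n I (r : seq I) (f : I -> milnor FX) :
  (forall i, low n (f i)) -> low n (\sum_(i <- r) f i).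
Proof. by move=> lf; elim/big_rec: _ => [|i y _ ly]; [exact: low0|apply: lowD]. Qed.

Lemma low_cst z : low 1 (milnor_map cst z).
Proof.
elim/milnor_ind: z => [||x y lx ly|a x a0 lx].
- by rewrite rmorph0; exact: low0.
- by rewrite rmorph1; exact: low1.
- by rewrite rmorphD; exact: lowD.
rewrite rmorphM milnor_map_brk; apply: lowMp => //; first by rewrite polyC_eq0.
by rewrite size_polyC a0.
Qed.

(** Nonzero polynomials of size at most 1 are constants, so the bottom of the filtration is the
    image of k_*(k). *)
Lemma low1_cst y : low 1 y -> exists z, y = milnor_map cst z.
Proof.
elim=> [||u v _ [z ->] _ [t ->]|p u p0 sp _ [z ->]].
- by exists 0; rewrite rmorph0.
- by exists 1; rewrite rmorph1.
- by exists (z + t); rewrite rmorphD.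
exists (brk p`_0 * z); rewrite rmorphM milnor_map_brk.
by rewrite [p in LHS](size1_polyC sp).
Qed.

(* [P] is the Q-adic place, with uniformizer [Q] and reduction map [ev]. *)
Definition place_at (L : fieldType) (ev : {rmorphism {poly k} -> L}) Q (P : place FX L) :=
  [/\ ev Q = 0, (forall a, exists p, ev p = a),
      forall p, ev p != 0 -> par P (phi p) = false /\ res P (phi p) = ev p
    & par P (phi Q) = true /\ res P (phi Q) = 1].

Section AtQ.
Variables (L : fieldType) (ev : {rmorphism {poly k} -> L}) (Q : {poly k}) (P : place FX L).
Hypotheses (Q_irr : irreducible_poly Q) (PQ : place_at ev Q P).

Let evQ : ev Q = 0. Proof. by case: PQ. Qed.

Let Q0 : Q != 0 := irredp_neq0 Q_irr.

Lemma ev_small_neq0 (p : {poly k}) : p != 0 -> (size p < size Q)%N -> ev p != 0.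
Proof.
move=> p0 sp; rewrite (ev_eq0 Q_irr evQ); apply: contraL sp => /(dvdp_leq p0).
by rewrite leqNgt.
Qed.

Lemma residue_ev p : ev p != 0 -> residue P (brk (phi p)) = (brk (ev p), 0).
Proof.
have [_ _ PE _] := PQ; move=> p0; have [h1 h2] := PE p p0.
rewrite residue_brk ?h1 ?h2 // phi_eq0.
by apply: contraNneq p0 => ->; rewrite rmorph0.
Qed.

Lemma residue_Q : residue P (brk (phi Q)) = (0, 1).
Proof.
have [_ _ _ [h1 h2]] := PQ.
by rewrite residue_brk ?h1 ?h2 ?phi_eq0 // brk1.
Qed.

(** Nonzero polynomials of degree less than that of [Q] are Q-adic units, and units have no xi
    component. *)
Lemma residue_low n y : (n < size Q)%N -> low n y -> (residue P y).2 = 0.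
Proof.
move=> nQ; elim=> [||u v _ IHu _ IHv|p u p0 sp _ IH].
- by rewrite rmorph0.
- by rewrite rmorph1.
- by rewrite rmorphD tameD /= IHu IHv addr0.
rewrite rmorphM residue_ev ?ev_small_neq0 ?(leq_ltn_trans sp) //.
by rewrite tameM /= IH mulr0 !mul0r !addr0.
Qed.

Lemma lift_ex a : exists p : {poly k}, (size p < size Q)%N /\ ev p = a.
Proof.
have [_ /(_ a)[p <-] _ _] := PQ; exists (p %% Q).
by rewrite ltn_modp Q0 {2}(divp_eq p Q) rmorphD rmorphM evQ mulr0 add0r.
Qed.

Definition lift_poly a := projT1 (cid (lift_ex a)).

Lemma size_lift a : (size (lift_poly a) < size Q)%N.
Proof. by rewrite /lift_poly; case: cid => p []. Qed.

Lemma lift_polyK a : ev (lift_poly a) = a.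
Proof. by rewrite /lift_poly; case: cid => p []. Qed.

Lemma lift_poly_uniq (p : {poly k}) : (size p < size Q)%N -> lift_poly (ev p) = p.
Proof.
move=> sp; apply/eqP; rewrite -subr_eq0; apply: contraT => d0.
have := ev_small_neq0 d0; rewrite rmorphB lift_polyK subrr eqxx; apply.
by rewrite (leq_ltn_trans (size_polyD _ _)) // size_polyN gtn_max size_lift.
Qed.

Lemma lift_poly_neq0 a : a != 0 -> lift_poly a != 0.
Proof. by apply: contraNneq => h; rewrite -(lift_polyK a) h rmorph0. Qed.

(* Multiplication by {Q} factors through k_*(k[X]/Q) modulo lower degrees: a
   product AB of lifts differs from the lift C of the product by some QS, and
   C / AB - QS / AB = 1. *)
Lemma low_mulQ n y : (size Q = n.+1)%N -> low n y -> (residue P y).1 = 0 ->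
  low n (brk (phi Q) * y).
Proof.
move=> sQ ly.
have sQ1 := Q_irr.1.
(* [G] lifts each letter of a word over [L] to its remainder modulo [Q]. The aim is that {Q} times
   the lift of a Milnor relation lies in [low n]. *)
pose G := free_ext (fun u : funits L => brk (phi (lift_poly (val u)))).
have lowG x : low n (G x).
  have [r ->] := free_alg_words x; rewrite /G free_ext_sum; apply: low_sum => w.
  rewrite free_ext_word; elim/big_rec: _ => [|u z _ lz]; first exact: low1.
  by apply: lowM => //; apply: low_brk; rewrite -ltnS -sQ size_lift.
(* The letters of [y] have size at most [n], hence are the remainders of their own values; so [y] is
   the lift of a word expression for its reduction. *)
have [x <- <-] : exists2 x, G x = y & api (milnor_rel (F := L)) x = (residue P y).1.
  elim: ly => [||u v _ [x ux rx] _ [x' vx rx']|p u p0 sp _ [x ux rx]].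
  - by exists 0; [exact: free_ext0|rewrite rmorph0 api0].
  - by exists 1; [exact: free_ext1|rewrite rmorph1 api1].
  - by exists (x + x'); rewrite ?apiD ?rmorphD ?rx ?rx' // /G free_extD -/G ux vx.
  have sp' : (size p < size Q)%N by rewrite sQ ltnS.
  have e0 := ev_small_neq0 p0 sp'; have [a [ap aE]] := brk_unit e0.
  exists (fword [:: a] * x).
    by rewrite /G free_extM free_ext_word big_seq1 -/G ux ap lift_poly_uniq.
  rewrite rmorphM residue_ev // tameM /= -rx aE; exact: apiM.
move=> /api_eq0 relx.
pose U := [set x | low n (brk (phi Q) * G x)]%classic.
suff : U x by []; apply: (@ideal_gen_sub _ _ U) relx => {x}; rewrite {}/U.
  apply: is_ideal_mk => [|x z Ux Uz|a x Ux|a x Ux] /=.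
  - by rewrite /G free_ext0 mulr0; exact: low0.
  - by rewrite /G free_extD mulrDr; exact: lowD.
  - rewrite /G free_extM -/G mulrA [_ * G a]milnorC -mulrA; exact: lowM.
  - rewrite /G free_extM -/G mulrA; exact: lowM.
move=> x [[a [b [c [cab ->]]]]|[a [b [ab ->]]]] /=.
  rewrite /G !free_extB !free_ext_word !big_seq1 -!addrA !f2oppr addrA.
  set A := lift_poly (val a); set B := lift_poly (val b); set C := lift_poly (val c).
  have A0 : A != 0 := lift_poly_neq0 (valP a).
  have B0 : B != 0 := lift_poly_neq0 (valP b).
  have C0 : C != 0 := lift_poly_neq0 (valP c).
  have /dvdpP[S SE] : Q %| C - A * B.
    by rewrite -(ev_eq0 Q_irr evQ) rmorphB rmorphM !lift_polyK cab subrr.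
  have AB0 : A * B != 0 by rewrite mulf_neq0.
  have lowA : low n (brk (phi A)) by apply: low_brk; rewrite -ltnS -sQ size_lift.
  have lowB : low n (brk (phi B)) by apply: low_brk; rewrite -ltnS -sQ size_lift.
  have lowC : low n (brk (phi C)) by apply: low_brk; rewrite -ltnS -sQ size_lift.
  have [S0|S0] := eqVneq S 0.
    have -> : C = A * B by apply/eqP; rewrite -subr_eq0 SE S0 mul0r.
    rewrite rmorphM brkM ?phi_eq0 // -!addrA [brk (phi B) + _]addrCA f2addrr addr0.
    by rewrite f2addrr mulr0; exact: low0.
  (* Since C has size at most n and AB at most 2n - 1, comparing sizes in C - AB = SQ bounds S. *)
  have sS : (size S <= n)%N.
    have := congr1 (size : {poly k} -> nat) SE.
    rewrite size_mul // sQ addnS /= => e.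
    have : (size S + n <= maxn n (n + n).-1)%N.
      rewrite -e (leq_trans (size_polyD _ _)) // size_polyN geq_max !leq_max.
      rewrite -ltnS -sQ size_lift /= size_mul //.
      rewrite (_ : _.-1 <= (n + n).-1)%N ?orbT // -!subn1 leq_sub2r // leq_add //.
        by rewrite -ltnS -sQ size_lift.
      by rewrite -ltnS -sQ size_lift.
    rewrite leq_max => /orP[|] h; first by rewrite (leq_trans _ h) // leq_addr.
    by rewrite -(leq_add2r n) (leq_trans h) // leq_pred.
  have st : phi C / phi (A * B) + phi (Q * - S) / phi (A * B) = 1.
    rewrite -mulrDl -rmorphD mulrN [Q * S]mulrC -SE opprB addrC subrK.
    by rewrite divff // phi_eq0.
  (* This reads ({C} + {A} + {B})({Q} + {-S} + {A} + {B}) = 0, so {Q}({C} + {A} + {B}) is a product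
     of two low elements. *)
  have := brk_steinberg st.
  rewrite !brk_div ?phi_eq0 ?mulf_neq0 ?oppr_eq0 // !rmorphM !brkM ?phi_eq0 ?oppr_eq0 //.
  rewrite -[X in _ * X]addrA mulrDr addrA milnorC => /eqP.
  rewrite addr_eq0 f2oppr => /eqP ->; apply: lowM; first by do !apply: lowD.
  by apply: lowD; [apply: low_brk; rewrite size_polyN|apply: lowD].
rewrite /G free_ext_word !big_cons big_nil mulr1.
(* Taking remainders respects 1 - a, so the Steinberg relation lifts exactly. *)
have -> : lift_poly (val b) = 1 - lift_poly (val a).
  rewrite -[val b](addKr (val a)) ab addrC -[val a in LHS]lift_polyK -(rmorph1 ev) -rmorphB.
  rewrite lift_poly_uniq // (leq_ltn_trans (size_polyD _ _)) //.
  by rewrite size_polyN gtn_max size_lift size_poly1 sQ1.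
rewrite brk_steinberg ?mulr0; first exact: low0.
by rewrite rmorphB rmorph1 addrC subrK.
Qed.

End AtQ.
End LowDegree.

Lemma tofrac_is_frac (R : idomainType) :
  is_frac (@FracField.tofrac R : {rmorphism R -> {fraction R}}).
Proof.
split=> [p q /eqP|x]; first by rewrite tofrac_eq => /eqP.
elim/quotW: x => r; exists \n_r, \d_r; rewrite denom_ratioP; split=> //.
apply: (canRL (mulfK _)); first by rewrite tofrac_eq0 denom_ratioP.
have tofracE p : (@FracField.tofrac R) p = (\pi_{fraction R} (Ratio p 1))%qT.
  by unlock FracField.tofrac.
rewrite /= !tofracE; apply: (etrans (esym (FracField.pi_mul r (Ratio \d_r 1)))).
apply/eqmodP.
rewrite /= FracField.equivfE /FracField.mulf.
rewrite !numden_Ratio ?mulf_neq0 ?denom_ratioP ?oner_neq0 ?oner_eq0 //.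
by rewrite !mulr1 mulrC.
Qed.

Lemma irreducible_quotient_field (k : fieldType) (Q : {poly k}) : irreducible_poly Q ->
  exists (L : fieldType) (ev : {rmorphism {poly k} -> L}),
    ev Q = 0 /\ forall a, exists p, ev p = a.
Proof.
move=> /irredp_FAdjoin[L _ [z Qz z_gen]].
pose ev : {rmorphism {poly k} -> L} := horner_eval z \o map_poly (in_alg L).
exists L, ev; split=> [|a]; first exact/eqP.
have : a \in <<1; z>>%VS by rewrite z_gen memvf.
case/Fadjoin_polyP => p /polyOver1P[q ->] ->.
by exists q.
Qed.

Lemma irreducible_scale (k : fieldType) (c : k) p : c != 0 ->
  irreducible_poly p -> irreducible_poly (c *: p).
Proof.
move=> c0 [sp pirr]; split=> [|q sq]; first by rewrite size_scale.
by rewrite dvdpZr // => /(pirr q sq) qp; rewrite (eqp_trans qp) // eqp_sym eqp_scale.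
Qed.

Lemma reducible_factor (k : fieldType) (p : {poly k}) : (1 < size p)%N ->
  ~ irreducible_poly p -> exists q r : {poly k},
    [/\ q != 0, r != 0, (size q < size p)%N, (size r < size p)%N & p = q * r].
Proof.
move=> sp pred; apply: contrapT => nex; apply: pred; split=> // q sq /dvdpP[r pE].
have p0 : p != 0 by rewrite -size_poly_gt0 ltnW.
have r0 : r != 0 by apply: contraNneq p0 => r0; rewrite pE r0 mul0r.
have q0 : q != 0 by apply: contraNneq p0 => q0; rewrite pE q0 mulr0.
have spE : size p = (size r + size q).-1 by rewrite pE size_mul.
have sq1 : (1 < size q)%N by rewrite ltn_neqAle eq_sym sq size_poly_gt0.
have [sr|sr] := leqP (size r) 1; last first.
  have lt m n : (1 < n -> m < (m + n).-1)%N.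
    by move=> n1; rewrite -subn1 -addnBA ?(ltnW n1) // -[X in (X < _)%N]addn0 ltn_add2l subn_gt0.
  have lr : (size r < size p)%N by rewrite spE; exact: lt.
  have lq : (size q < size p)%N by rewrite spE addnC; exact: lt.
  by case: nex; exists r, q; split.
have rE := size1_polyC sr; rewrite pE rE mul_polyC eqp_sym eqp_scale //.
by have := r0; rewrite {1}rE polyC_eq0.
Qed.

(** * Lowering the degree when residues vanish *)

Section Descent.
Variables (k FX : fieldType) (phi : {rmorphism {poly k} -> FX}).
Hypothesis phi_frac : is_frac phi.

Let phi_eq0 := is_frac_eq0 phi_frac.

Lemma place_at_ex Q : irreducible_poly Q ->
  exists (L : fieldType) (ev : {rmorphism {poly k} -> L}) (P : place FX L),
    place_at phi ev Q P.
Proof.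
move=> Qirr; have [L [ev [evQ evS]]] := irreducible_quotient_field Qirr.
by have [P [P1 P2]] := finite_place_ex phi_frac Qirr evQ; exists L, ev, P.
Qed.

Variable n : nat.
Hypothesis n_gt0 : (0 < n)%N.

(** The pair stands for the product {Q} z. Monic polynomials are used so that distinct ones are
    coprime and their difference has lower degree. *)
Definition good_pair (c : {poly k} * milnor FX) :=
  [/\ irreducible_poly c.1, c.1 \is monic, size c.1 = n.+1 & low phi n c.2].

Definition pairs_sum (s : seq ({poly k} * milnor FX)) :=
  \sum_(c <- s) brk (phi c.1) * c.2.

(** A normal form that is linear in the classes of irreducible polynomials of degree n, with low
    coefficients. *)
Definition norm_form y := exists l s,
  [/\ low phi n l, {in s, forall c, good_pair c} & y = l + pairs_sum s].

Lemma norm_formD y z : norm_form y -> norm_form z -> norm_form (y + z).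
Proof.
move=> [l [s [ll gs ->]]] [l' [s' [ll' gs' ->]]]; exists (l + l'), (s ++ s').
split; first exact: lowD.
  by move=> c; rewrite mem_cat => /orP[/gs|/gs'].
by rewrite /pairs_sum big_cat /= addrACA.
Qed.

Lemma norm_form_low y : low phi n y -> norm_form y.
Proof. by move=> ly; exists y, [::]; rewrite /pairs_sum big_nil addr0. Qed.

Lemma norm_form_pair Q z : good_pair (Q, z) -> norm_form (brk (phi Q) * z).
Proof.
move=> gQ; exists 0, [:: (Q, z)]; rewrite /pairs_sum big_seq1 add0r; split=> //.
  exact: low0.
by move=> c; rewrite inE => /eqP ->.
Qed.

Lemma norm_form_mul_low l y : low phi n l -> norm_form y -> norm_form (l * y).
Proof.
move=> ll [l' [s [ll' gs ->]]].
exists (l * l'), [seq (c.1, l * c.2) | c <- s]; split; first exact: lowM.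
  by move=> c /mapP[d /gs[h1 h2 h3 h4] ->]; split=> //=; exact: lowM.
rewrite mulrDr /pairs_sum big_map mulr_sumr; congr (_ + _); apply: eq_bigr => c _.
by rewrite /= !mulrA [l * _]milnorC.
Qed.

(* For [Q' != Q] the remainder [R = Q - Q'] has lower degree and
   [Q / Q' - R / Q' = 1]. *)
Lemma norm_form_mulQ Q y : irreducible_poly Q -> Q \is monic -> size Q = n.+1 ->
  norm_form y -> norm_form (brk (phi Q) * y).
Proof.
move=> Qirr Qmon sQ [l [s [ll gs ->]]]; rewrite mulrDr.
apply: norm_formD; first exact: norm_form_pair.
rewrite /pairs_sum mulr_sumr big_seq; elim/big_rec: _ => [|c z /gs[]].
  by apply: norm_form_low; exact: low0.
case: c => Q' u /= Q'irr Q'mon sQ' lu nz; apply: norm_formD => //.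
have low1N : low phi n (brk (-1)).
  rewrite -(rmorph1 phi) -rmorphN.
  by apply: low_brk; rewrite size_polyN size_poly1.
rewrite mulrA; have [<-|QQ'] := eqVneq Q Q'.
  rewrite brk_sqr -mulrA; apply: norm_form_pair; split=> //.
  exact: lowM.
have Q0 := monic_neq0 Qmon; have Q'0 := monic_neq0 Q'mon.
have R0 : Q - Q' != 0 by rewrite subr_eq0.
have sR : (size (Q - Q')%R <= n)%N.
  apply/leq_sizeP => j; rewrite leq_eqVlt => /orP[/eqP <-|nj].
    have := monicP Qmon; have := monicP Q'mon; rewrite /lead_coef sQ sQ' /= coefB => -> ->.
    by rewrite subrr.
  by rewrite coefB !nth_default ?subrr ?sQ ?sQ'.
have st : phi Q / phi Q' + phi (- (Q - Q')) / phi Q' = 1.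
  by rewrite -mulrDl -rmorphD opprB addrC subrK divff ?phi_eq0.
(* With R = Q - Q', the expansion gives {Q}{Q'} = {Q}{-R} + {Q'}{-R} + {Q'}{-1}, which is linear in
   {Q} and {Q'}. *)
have := brk_steinberg st; rewrite !brk_div ?phi_eq0 ?oppr_eq0 //.
rewrite mulrDr [X in _ + X]mulrDl addrA addrAC => /eqP; rewrite addr_eq0 f2oppr => /eqP e.
rewrite -e brk_sqr !mulrDl -!mulrA.
have lowr : low phi n (brk (phi (- (Q - Q')))) by apply: low_brk; rewrite size_polyN.
by do 2?apply: norm_formD; apply: norm_form_pair; split=> //=; exact: lowM.
Qed.

(** A generator of size n + 1 is either irreducible, hence monic up to a constant, or a product of
    two polynomials of size at most n; normal forms are stable under multiplication by both
    kinds. *)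
Lemma norm_formP y : low phi n.+1 y -> norm_form y.
Proof.
elim=> [||u v _ IHu _ IHv|p u p0 sp _ IH].
- by apply: norm_form_low; exact: low0.
- by apply: norm_form_low; exact: low1.
- exact: norm_formD.
move: sp; rewrite leq_eqVlt => /orP[/eqP sp|]; last first.
  by rewrite ltnS => sp; apply: norm_form_mul_low => //; exact: low_brk.
have [pirr|pred] := pselect (irreducible_poly p).
  have lc0 : lead_coef p != 0 by rewrite lead_coef_eq0.
  rewrite -[p in phi p](scalerKV lc0) -mul_polyC rmorphM brkM ?phi_eq0; last 2 first.
  - by rewrite polyC_eq0.
  - by rewrite scaler_eq0 negb_or invr_eq0 lc0.
  rewrite mulrDl; apply: norm_formD.
    by apply: norm_form_mul_low => //; apply: low_brk; rewrite size_polyC lc0.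
  apply: norm_form_mulQ => //.
  - by apply: irreducible_scale => //; rewrite invr_eq0.
  - by rewrite monicE lead_coefZ mulVf.
  - by rewrite size_scale ?invr_eq0.
have [q [r [q0 r0 sq sr ->]]] : exists q r : {poly k},
    [/\ q != 0, r != 0, (size q <= n)%N, (size r <= n)%N & p = q * r].
  have [|q [r [q0 r0 sq sr pE]]] := reducible_factor _ pred; first by rewrite sp.
  by exists q, r; split=> //; rewrite -ltnS -sp.
rewrite rmorphM brkM ?phi_eq0 // mulrDl; apply: norm_formD.
  by apply: norm_form_mul_low => //; exact: low_brk.
by apply: norm_form_mul_low => //; exact: low_brk.
Qed.

(** Induction on the number of pairs. Those sharing the first polynomial Q add up to {Q} t, and the
    other polynomials are units at Q, so the Q-adic residue forces t to reduce to 0. Then [low_mulQ]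
    makes {Q} t low, and the remaining pairs still have no residues. *)
Lemma pairs_sum_low (s : seq ({poly k} * milnor FX)) : {in s, forall c, good_pair c} ->
  (forall Q (L : fieldType) (ev : {rmorphism {poly k} -> L}) (P : place FX L),
     irreducible_poly Q -> size Q = n.+1 -> place_at phi ev Q P ->
     (residue P (pairs_sum s)).2 = 0) -> low phi n (pairs_sum s).
Proof.
have [m] := ubnP (size s); elim: m s => // m IH [|[Q z] s] sm gs rs.
  by rewrite /pairs_sum big_nil; exact: low0.
set s1 := [seq c <- (Q, z) :: s | c.1 == Q]; set s2 := [seq c <- (Q, z) :: s | c.1 != Q].
have sE : pairs_sum ((Q, z) :: s) = pairs_sum s1 + pairs_sum s2.
  by rewrite /pairs_sum !big_filter (bigID (fun c => c.1 == Q)).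
have gs1 : {in s1, forall c, good_pair c} by move=> c; rewrite mem_filter => /andP[_ /gs].
have gs2 : {in s2, forall c, good_pair c} by move=> c; rewrite mem_filter => /andP[_ /gs].
have [Qirr Qmon sQ lz] : good_pair (Q, z) by apply: gs; rewrite inE eqxx.
pose t : milnor FX := \sum_(c <- s1) c.2.
have s1E : pairs_sum s1 = brk (phi Q) * t.
  rewrite mulr_sumr /pairs_sum big_seq [RHS]big_seq; apply: eq_bigr => c.
  by rewrite mem_filter => /andP[/eqP -> _].
have lt : low phi n t.
  by rewrite /t big_seq; elim/big_rec: _ => [|c y /gs1[_ _ _ lc] ly]; [exact: low0|exact: lowD].
have low_s1 : low phi n (pairs_sum s1).
  rewrite s1E; have [L [ev [P PQ]]] := place_at_ex Qirr.
  apply: (low_mulQ phi_frac Qirr PQ) => //.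
  have r2 : (residue P (pairs_sum s2)).2 = 0.
    rewrite /pairs_sum big_seq; elim/big_rec: _ => [|c y cs2 ry]; first by rewrite rmorph0.
    have [cirr cmon sc lc] := gs2 c cs2; move: cs2; rewrite mem_filter => /andP[cQ _].
    rewrite rmorphD tameD /= ry addr0 rmorphM (residue_ev phi_frac PQ).
      by rewrite tameM /= (residue_low phi_frac Qirr PQ _ lc) ?sQ // !(mulr0, mul0r, addr0).
    rewrite (ev_eq0 Qirr); last by case: PQ.
    apply: contra cQ => Qc; rewrite -eqp_monic // eqp_sym.
    by apply: cirr.2 => //; rewrite neq_ltn Qirr.1 orbT.
  have := rs Q L ev P Qirr sQ PQ.
  rewrite sE s1E rmorphD tameD /= r2 addr0 rmorphM (residue_Q phi_frac Qirr PQ) tameM /=.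
  rewrite (residue_low phi_frac Qirr PQ _ lt) ?sQ // !mul0r mul1r.
  by rewrite !(add0r, addr0, mulr0) mul0r addr0.
rewrite sE; apply: lowD => //; apply: IH => //.
  apply: leq_ltn_trans (sm : (size s < m)%N).
  by rewrite /s2 /= eqxx /= size_filter count_size.
move=> Q' L ev P Q'irr sQ' PQ'.
have := rs Q' L ev P Q'irr sQ' PQ'.
by rewrite sE rmorphD tameD /= (residue_low phi_frac Q'irr PQ' _ low_s1) ?sQ' // add0r.
Qed.

(** On the graded pieces of the filtration this is the injectivity of the residues at the places of
    degree n, a part of Milnor's exact sequence for the rational function field. *)
Lemma low_descent y : low phi n.+1 y ->
  (forall Q (L : fieldType) (ev : {rmorphism {poly k} -> L}) (P : place FX L),
     irreducible_poly Q -> size Q = n.+1 -> place_at phi ev Q P ->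
     (residue P y).2 = 0) -> low phi n y.
Proof.
move=> /norm_formP[l [s [ll gs ->]]] rs; apply: lowD => //; apply: pairs_sum_low => //.
move=> Q L ev P Qirr sQ PQ; have := rs Q L ev P Qirr sQ PQ.
by rewrite rmorphD tameD /= (residue_low phi_frac Qirr PQ _ ll) ?sQ // add0r.
Qed.

End Descent.

Lemma milnor_map_odd_simple (k E : fieldType) (ev : {rmorphism {poly k} -> E}) (Q : {poly k})
    (i : {rmorphism k -> E}) :
  irreducible_poly Q -> Q \is monic -> odd (size Q).-1 -> ev Q = 0 ->
  (forall a, exists p, ev p = a) -> (forall a, i a = ev a%:P) ->
  forall z, milnor_map i z = 0 -> z = 0.
Proof.
move=> Qirr Qmon Qodd evQ evS iE z iz0.
pose FX := {fraction {poly k}}; pose phi : {rmorphism {poly k} -> FX} := @FracField.tofrac {poly k}.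
have phi_frac : is_frac phi := tofrac_is_frac _.
pose c : {rmorphism k -> FX} := phi \o polyC.
pose y := milnor_map c z.
have [P [P1 P2]] := finite_place_ex phi_frac Qirr evQ.
have PQ : place_at phi ev Q P by [].
have [n sQ] : exists n, size Q = n.+2.
  by move: Qodd; case: (size Q) => [|[|n]] // _; exists n.
have ly : low phi n.+1 y by apply: low_le (low_cst phi z).
have lQy : low phi n.+1 (brk (phi Q) * y).
  (* The reduction of [y] modulo [Q] is the image of [z] in k_*(E), which vanishes. *)
  apply: (low_mulQ phi_frac Qirr PQ) => //.
  rewrite /y (residue_const (j := i)) ?iz0 // => a a0.
  have ea : ev a%:P != 0 by rewrite -iE fmorph_eq0.
  by have [-> ->] := P1 _ ea; rewrite iE.
have l1 : low phi 1 (brk (phi Q) * y).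
  suff down m : (m <= n)%N -> low phi m.+1 (brk (phi Q) * y) -> low phi 1 (brk (phi Q) * y).
    exact: (down n).
  elim: m => // m IH mn lm; apply: IH; first exact: ltnW.
  (* At a place R of degree less than that of [Q], both [Q] and the constants are units, so there is
     no residue. *)
  apply: (low_descent phi_frac) => // R L evR PR Rirr sR PRR.
  have QR : evR Q != 0.
    rewrite (ev_eq0 Rirr); last by case: PRR.
    apply: contraL mn => RQ.
    have sR1 : size R != 1%N by rewrite sR.
    by have /eqp_size := Qirr.2 R sR1 RQ; rewrite sR sQ => -[->]; rewrite ltnn.
  rewrite rmorphM (residue_ev phi_frac PRR QR).
  have [_ _ PR1 _] := PRR.
  rewrite (residue_const (j := evR \o polyC)); last first.
    by move=> a a0; apply: PR1; rewrite -[evR _]/((evR \o polyC) a) fmorph_eq0.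
  by rewrite tameM /= !(mulr0, mul0r, addr0).
have [w wE] := low1_cst l1.
have [Pi PiE] := infinite_place_ex phi_frac.
have Pc u : residue Pi (milnor_map c u) = (u, 0).
  rewrite (residue_const (j := idfun)) ?milnor_map_id // => a a0.
  by have [|-> ->] := PiE a%:P; rewrite ?polyC_eq0 // size_polyC a0 lead_coefC.
(* At infinity {Q} has residue xi, as [Q] is monic of odd degree; so {Q} y has xi component z, while
   the constant [w] has none. *)
have := congr1 (fun x => (residue Pi x).2) wE.
rewrite rmorphM !Pc /= residue_brk; last by rewrite tofrac_eq0 monic_neq0.
have [-> ->] := PiE Q (monic_neq0 Qmon).
by rewrite Qodd (monicP Qmon) brk1 /tameM /= !(mul0r, mulr0, mul1r, add0r, addr0).
Qed.

(** * Extensions of odd degree *)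

Lemma dim_fieldOver (k : fieldType) (F : fieldExtType k) (E : {subfield F}) :
  \dim {:fieldOver E} = (\dim {:F} %/ \dim E)%N.
Proof.
rewrite -(dim_aspaceOver (subvf E)); congr (\dim _).
apply/esym/vspaceP => x; rewrite memvf mem_aspaceOver ?subvf //.
exact: (@memvf _ F).
Qed.

Lemma milnor_map_odd_adjoin (k : fieldType) (F : fieldExtType k) (x : F) :
  odd (\dim <<1; x>>) ->
  forall z, milnor_map (GRing.in_alg (subvs_of <<1; x>>%AS) : {rmorphism k -> _}) z = 0 ->
    z = 0.
Proof.
move=> xodd; set L := subvs_of _.
have xE : x \in <<1; x>>%VS := memv_adjoin _ _.
pose y : L := Subvs xE.
pose ev : {rmorphism {poly k} -> L} := horner_eval y \o map_poly (in_alg L).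
have val_ev p : vsval (ev p) = (map_poly (in_alg F) p).[x].
  rewrite /= /horner_eval -[x]/(vsval y) -horner_map -map_poly_comp.
  congr (_.[_]); apply: eq_map_poly => a /=.
  by rewrite algid1.
have /polyOver1P[Q QE] := minPolyOver 1%AS x.
have sQ : (size Q).-1 = \dim <<1; x>>.
  have := size_minPoly 1%AS x; rewrite QE size_map_poly => -> /=.
  by rewrite dim_Fadjoin dimv1 muln1.
apply: (@milnor_map_odd_simple _ _ ev Q) => //.
- split=> [|p sp pQ].
    by rewrite -(size_map_poly (in_alg F)) -QE size_minPoly.
  have := @minPoly_irr _ _ 1%AS x (map_poly (in_alg F) p).
  rewrite QE dvdp_map eqp_map pQ alg_polyOver => /(_ isT isT) /orP[//|].
  by rewrite -(rmorph1 (map_poly (in_alg F))) eqp_map -size_poly_eq1 (negPf sp).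
- by rewrite -(map_monic (in_alg F)) -QE monic_minPoly.
- by rewrite sQ.
- by apply: val_inj; rewrite -[LHS]/(vsval (ev Q)) val_ev -QE minPolyxx.
- move=> a; have := valP a; case/Fadjoin_polyP => p /polyOver1P[q ->] aE.
  by exists q; apply: val_inj; rewrite -[LHS]/(vsval (ev q)) val_ev.
- by move=> a; rewrite /= /horner_eval map_polyC hornerC.
Qed.

(** Induction on the degree along k, k(x), F with x outside k: both intermediate degrees divide an
    odd number. For F = k the simple case is used with the polynomial X and evaluation at 0. *)
Lemma milnor_map_odd (k : fieldType) (F : fieldExtType k) : odd (\dim {:F}) ->
  forall z, milnor_map (GRing.in_alg F : {rmorphism k -> F}) z = 0 -> z = 0.
Proof.
have [n] := ubnP (\dim {:F}); elim: n k F => // n IH k F; rewrite ltnS => Fn Fodd z z0.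
have [F1|] := eqVneq {:F}%VS 1%VS.
  have surj a : exists b, b%:A = a :> F.
    by have := memvf a; rewrite F1 => /vlineP[b ->]; exists b.
  pose ev : {rmorphism {poly k} -> F} := in_alg F \o horner_eval 0.
  apply: (@milnor_map_odd_simple _ _ ev 'X _ _ _ _ _ _ _ z z0).
  - by rewrite -['X]subr0 -polyC0; apply: irredp_XsubC.
  - exact: monicX.
  - by rewrite size_polyX.
  - by rewrite /= /horner_eval hornerX scale0r.
  - by move=> a; have [b <-] := surj a; exists b%:P; rewrite /= /horner_eval hornerC.
  - by move=> a; rewrite /= /horner_eval hornerC.
rewrite eqEsubv sub1v andbT => /subvPn[x _ x1].
pose E := <<1; x>>%AS.
have E1 : (1 < \dim E)%N.
  rewrite ltnNge; apply: contra x1 => E1.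
  suff /eqP -> : 1%VS == E :> {vspace F} by exact: memv_adjoin.
  by rewrite eqEdim sub1v dimv1.
have dE := dim_fieldOver E.
have Edvd : (\dim E %| \dim {:F})%N by apply: field_dimS; rewrite subvf.
have Eodd : odd (\dim E) by apply: dvdn_odd Edvd Fodd.
apply: (milnor_map_odd_adjoin Eodd).
apply: (IH (subvs_of E) (fieldOver E)).
- by rewrite dE (leq_trans _ Fn) // ltn_Pdiv // adim_gt0.
- by rewrite dE; move: Fodd; rewrite -{1}(divnK Edvd) oddM => /andP[].
rewrite -[RHS]z0; apply/esym.
apply: (milnor_map_comp (h := GRing.in_alg F : {rmorphism k -> fieldOver E})) => a.
by rewrite /= fieldOver_scaleE mulr1 /= algid1.
Qed.

(** * Flexible fields *)

Section RationalSubfield.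
Import mpoly.

Lemma rmorph_mmap n (R S T : comNzRingType) (g : {rmorphism S -> T})
    (f : {rmorphism R -> S}) (h : 'I_n -> S) (f' : R -> T) (h' : 'I_n -> T) p :
  g \o f =1 f' -> g \o h =1 h' -> g (mmap f h p) = mmap f' h' p.
Proof.
move=> ff' hh'; rewrite /mmap rmorph_sum; apply: eq_bigr => m _.
rewrite rmorphM /mmap1 rmorph_prod -ff'; congr (_ * _); apply: eq_bigr => j _.
by rewrite rmorphXn -hh'.
Qed.

Lemma mmap_id n (R : comNzRingType) (p : mpoly n R) :
  mmap (@mpolyC n R) (fun j => 'X_j) p = p.
Proof.
rewrite [RHS]mpolyE /mmap; apply: eq_bigr => m _.
by rewrite mmap1_id mul_mpolyC.
Qed.

Definition rename n n' (R : comNzRingType) (f : 'I_n -> 'I_n') : mpoly n R -> mpoly n' R :=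
  mmap (@mpolyC n' R) (fun j => 'X_(f j)).

HB.instance Definition _ n n' (R : comNzRingType) (f : 'I_n -> 'I_n') :=
  GRing.RMorphism.on (@rename n n' R f).

Lemma mmap_rename n n' (R S : comNzRingType) (f : 'I_n -> 'I_n') (i : {rmorphism R -> S})
    (h : 'I_n' -> S) p : mmap i h (rename f p) = mmap i (h \o f) p.
Proof.
apply: (rmorph_mmap (g := mmap i h)) => [a|j] /=; first exact: mmapC.
by rewrite mmapX mmap1U.
Qed.

Variables (k0 k : fieldType) (i : {rmorphism k0 -> k}).

Definition mev (t : nat -> k) n : mpoly n k0 -> k := mmap i (fun j => t j).

HB.instance Definition _ t n := GRing.RMorphism.on (@mev t n).

Definition alg_indep t := forall n (p : mpoly n k0), mev t p = 0 -> p = 0.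

Lemma mev_widen t n n' (le : (n <= n')%N) p : mev t (rename (widen_ord le) p) = @mev t n p.
Proof. exact: mmap_rename. Qed.

Definition rational_in (t : nat -> k) : {pred k} :=
  fun x => `[< exists n (p q : mpoly n k0), mev t q != 0 /\ x = mev t p / mev t q >].

Lemma rational_inP t x : reflect
  (exists n (p q : mpoly n k0), mev t q != 0 /\ x = mev t p / mev t q) (x \in rational_in t).
Proof. exact: asboolP. Qed.

Fact rational_in_divring_closed t : divring_closed (rational_in t).
Proof.
have common x y : x \in rational_in t -> y \in rational_in t ->
    exists n (p q p' q' : mpoly n k0), [/\ mev t q != 0, mev t q' != 0,
      x = mev t p / mev t q & y = mev t p' / mev t q'].
  move=> /rational_inP[n [p [q [q0 ->]]]] /rational_inP[n' [p' [q' [q0' ->]]]].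
  pose w := rename (widen_ord (leq_maxl n n')); pose w' := rename (widen_ord (leq_maxr n n')).
  by exists (maxn n n'), (w _ p), (w _ q), (w' _ p'), (w' _ q'); rewrite !mev_widen.
split=> [|x y xt yt|x y xt yt].
- by apply/rational_inP; exists 0%N, 1, 1; rewrite rmorph1 divr1 oner_neq0.
- have [n [p [q [p' [q' [q0 q0' -> ->]]]]]] := common x y xt yt.
  apply/rational_inP; exists n, (p * q' - p' * q), (q * q').
  rewrite rmorphB !rmorphM mulf_neq0 //; split=> //.
  by rewrite -[X in _ + X = _]mulNr addf_div // mulNr.
have [n [p [q [p' [q' [q0 q0' -> ->]]]]]] := common x y xt yt.
(* Division by zero gives 0, which has to be rational too. *)
have [p0|p0] := eqVneq (mev t p') 0.
  apply/rational_inP; exists n, 0, 1.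
  by rewrite rmorph0 rmorph1 oner_neq0 p0 mul0r invr0 mulr0 mul0r.
apply/rational_inP; exists n, (p * q'), (q * p'); rewrite !rmorphM mulf_neq0 //.
by rewrite invf_div mulf_div.
Qed.

HB.instance Definition _ t :=
  GRing.isDivringClosed.Build k (rational_in t) (rational_in_divring_closed t).

Definition rat_field t := {x : k | x \in rational_in t}.

HB.instance Definition _ t := SubChoice.on (rat_field t).
HB.instance Definition _ t := [SubChoice_isSubComUnitRing of rat_field t by <:].
HB.instance Definition _ t := [SubComUnitRing_isSubIntegralDomain of rat_field t by <:].
HB.instance Definition _ t := [SubIntegralDomain_isSubField of rat_field t by <:].

End RationalSubfield.

Section Independence.
Import mpoly.
Variables (k0 k : fieldType) (i : {rmorphism k0 -> k}).

Lemma rename_inj n n' (R : comNzRingType) (f : 'I_n -> 'I_n') : injective f ->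
  injective (@rename n n' R f).
Proof.
move=> f_inj; pose g (a : 'I_n') : mpoly n R := if [pick j | f j == a] is Some j then 'X_j else 0.
apply: (@can_inj _ _ _ (mmap (@mpolyC n R) g)) => p; rewrite mmap_rename -[RHS]mmap_id.
congr (mmap _ _ _); apply/funext => j /=; rewrite /g.
by case: pickP => [j' /eqP /f_inj ->|/(_ j)]; rewrite ?eqxx.
Qed.

(** Independence is assumed for initial segments only; a finite selection is renamed injectively
    into a long enough one. *)
Lemma alg_indep_comp t n (f : 'I_n -> nat) (p : mpoly n k0) : injective f ->
  alg_indep i t -> mmap i (t \o f) p = 0 -> p = 0.
Proof.
move=> f_inj t_indep p0.
pose N := (\max_(j < n) f j).+1.
have fN j : (f j < N)%N by rewrite ltnS (leq_bigmax j).
pose g j := Ordinal (fN j).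
have g_inj : injective g by move=> j j' /(congr1 val) /f_inj.
apply: (rename_inj g_inj); rewrite rmorph0; apply: (t_indep N).
by rewrite -p0 /mev mmap_rename.
Qed.

(* With [x] adjoined as a last variable, a polynomial over [mpoly n k0] becomes an
   element of [mpoly n.+1 k0]. *)
Lemma horner_mev_inj (t : nat -> k) x n (p : {poly mpoly n k0}) :
  (forall q : mpoly n.+1 k0,
     mmap i (fun j : 'I_n.+1 => if (j < n)%N then t j else x) q = 0 -> q = 0) ->
  (map_poly (mev i t (n := n)) p).[x] = 0 -> p = 0.
Proof.
move=> tx_indep p0.
pose w := @rename n n.+1 k0 (widen_ord (leqnSn n)).
pose S := (map_poly w p).['X_ord_max].
have S0 : S = 0.
  apply: tx_indep; rewrite -p0 /S -horner_map -map_poly_comp /=.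
  rewrite [X in _.[X] = _]mmapX mmap1U /= ltnn; congr (_.[_]).
  apply: eq_map_poly => q /=; rewrite /mev mmap_rename.
  by congr (mmap _ _ _); apply/funext => j /=; rewrite ltn_ord.
pose v (a : 'I_n.+1) : {poly mpoly n k0} :=
  if unlift ord_max a is Some j then ('X_j)%:P else 'X.
(* [Theta] sends the last variable back to X and the others to constants, so it recovers [p] from
   [S]. *)
pose Theta : mpoly n.+1 k0 -> {poly mpoly n k0} := mmap (polyC \o @mpolyC n k0) v.
have : Theta S = 0 by rewrite S0 /Theta rmorph0.
rewrite /S /Theta -horner_map -map_poly_comp /= mmapX mmap1U /v unlift_none.
have -> : map_poly (mmap (polyC \o @mpolyC n k0) v \o w) p = map_poly polyC p.
  apply: eq_map_poly => q /=; rewrite /w mmap_rename -[in RHS](mmap_id q).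
  apply: esym; apply: rmorph_mmap => // j /=.
  rewrite /v (_ : widen_ord _ j = lift ord_max j) ?liftK //.
  by apply: val_inj; rewrite /= /bump leqNgt ltn_ord.
by rewrite -/(comp_poly 'X p) comp_polyXr.
Qed.

End Independence.

(** * Splitting one variable off a flexible field *)

Module FlexibleStep.
Section FlexibleStep.
Import mpoly.
Variables (k0 k : fieldType) (i : {rmorphism k0 -> k}) (t : nat -> k).
Hypothesis t_indep : alg_indep i t.
Hypothesis t_gen : forall x, x \in rational_in i t.
Variable N : nat.

(** [bump N] skips [N], so [s] is [t] without t_N. The field [K] generated by [s] is flexible and k
    = K(t_N). *)
Let s := t \o bump N.
Let K := rat_field i s.

Definition incl_K : K -> k := val.
HB.instance Definition _ := GRing.RMorphism.on incl_K.

Lemma rat_field_base a : i a \in rational_in i s.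
Proof.
by apply/rational_inP; exists 0%N, a%:MP, 1; rewrite rmorph1 oner_neq0 divr1 /mev mmapC.
Qed.

Lemma rat_field_gen j : s j \in rational_in i s.
Proof.
apply/rational_inP; exists j.+1, 'X_ord_max, 1; rewrite rmorph1 oner_neq0 divr1.
by rewrite /mev mmapX mmap1U.
Qed.

Definition base_K a : K := Sub (i a) (rat_field_base a).
Definition gen_K j : K := Sub (s j) (rat_field_gen j).

Fact base_K_zmod : zmod_morphism base_K.
Proof. by move=> a b; apply: val_inj; rewrite rmorphB /= rmorphB. Qed.
Fact base_K_monoid : monoid_morphism base_K.
Proof. by split=> [|a b]; apply: val_inj; rewrite /= ?rmorph1 ?rmorphM. Qed.
HB.instance Definition _ := GRing.isZmodMorphism.Build k0 K base_K base_K_zmod.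
HB.instance Definition _ := GRing.isMonoidMorphism.Build k0 K base_K base_K_monoid.

Lemma val_mev n (p : mpoly n k0) : val (mev base_K gen_K p) = mev i s p.
Proof. exact: (rmorph_mmap (g := val)). Qed.

Lemma rat_field_flexible : flexible K.
Proof.
exists k0, base_K, gen_K; split=> [n p p0|x].
  apply: (alg_indep_comp (f := fun j => bump N j) _ t_indep).
    by move=> j j' /(can_inj (bumpK N)) e; apply: val_inj.
  by rewrite -[LHS](val_mev p) /mev p0.
have /rational_inP[n [p [q [q0 xE]]]] := valP x.
exists n, p, q; split.
  by rewrite -(inj_eq val_inj) -/(mev base_K gen_K q) val_mev rmorph0.
by apply: val_inj; rewrite fmorph_div -!val_mev in xE *.
Qed.

Definition poly_K : {poly K} -> k := horner_eval (t N) \o map_poly incl_K.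
HB.instance Definition _ := GRing.RMorphism.on poly_K.

Lemma poly_KE p : poly_K p = (map_poly incl_K p).[t N]. Proof. by []. Qed.

Lemma poly_KC a : poly_K a%:P = val a.
Proof. by rewrite poly_KE map_polyC hornerC. Qed.

(** Clearing denominators turns a relation for t_N over [K] into one with polynomial coefficients,
    to which independence applies. *)
Lemma common_denominator (P : {poly K}) :
  exists n (c : {poly mpoly n k0}) (d : mpoly n k0),
    mev i s d != 0 /\ map_poly incl_K P = (mev i s d)^-1 *: map_poly (mev i s (n := n)) c.
Proof.
elim/poly_ind: P => [|P a [n [c [d [d0 PE]]]]].
  by exists 0%N, 0, 1; rewrite !rmorph0 scaler0 rmorph1 oner_neq0.
have /rational_inP[n' [p [q [q0 aE]]]] := valP a.
pose w := @rename n _ k0 (widen_ord (leq_maxl n n')).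
pose w' := @rename n' _ k0 (widen_ord (leq_maxr n n')).
have -> : map_poly incl_K (P * 'X + a%:P) = map_poly incl_K P * 'X + (incl_K a)%:P.
  by rewrite rmorphD rmorphM /= map_polyX map_polyC.
rewrite PE [incl_K a]aE.
exists (maxn n n'), ((w' q)%:P * map_poly w c * 'X + (w d * w' p)%:P), (w d * w' q).
have wE r : mev i s (w r) = mev i s r := mev_widen i s _ r.
have wE' r : mev i s (w' r) = mev i s r := mev_widen i s _ r.
have mapw : map_poly (mev i s (n := maxn n n')) (map_poly w c) = map_poly (mev i s (n := n)) c.
  by rewrite -map_poly_comp; apply: eq_map_poly.
rewrite [mev _ _ (_ * _)]rmorphM /= wE wE' mulf_neq0 //; split=> //.
rewrite rmorphD !rmorphM /= map_polyX !map_polyC mapw /= wE wE'.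
rewrite scalerDr; congr (_ + _).
  by rewrite -!scalerAl mul_polyC -scalerAl scalerA invfM -mulrA mulVf // mulr1.
by rewrite -!polyCM -mul_polyC -polyCM wE' invfM mulrACA mulVf // mul1r mulrC.
Qed.

Lemma poly_K_frac : is_frac (poly_K : {rmorphism {poly K} -> k}).
Proof.
split=> [|x].
  apply: raddf_inj => P P0.
  have [n [c [d [d0 PE]]]] := common_denominator P.
  have c0 : c = 0.
    apply: (horner_mev_inj (i := i) (t := s) (x := t N)) => [q q0|].
      (* The first [n] terms of [s] followed by t_N are an injective selection from [t]. *)
      apply: (alg_indep_comp (f := fun j => if (j < n)%N then bump N j else N) _ t_indep).
        move=> j j'; case: ltnP => jn; case: ltnP => jn'.
        - by move/(can_inj (bumpK N)) => e; apply: val_inj.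
        - by move/esym => h; have := neq_bump N j; rewrite -h eqxx.
        - by move=> h; have := neq_bump N j'; rewrite -h eqxx.
        - move=> _; apply: val_inj; apply/eqP.
          by rewrite eqn_leq (leq_trans _ jn') ?(leq_trans _ jn) // -ltnS ltn_ord.
      rewrite -[RHS]q0; congr (mmap _ _ _); apply/funext => j /=.
      by case: ltnP.
    have : (map_poly incl_K P).[t N] = 0 := P0; rewrite PE hornerZ => /eqP.
    by rewrite mulf_eq0 invr_eq0 (negPf d0) => /eqP.
  apply: (map_poly_inj incl_K).
  by rewrite PE c0 !rmorph0 scaler0.
pose h n (j : 'I_n) : {poly K} := if j == N :> nat then 'X else (gen_K (unbump N j))%:P.
have hE n p : poly_K (mmap (polyC \o base_K) (@h n) p) = mev i t p.
  apply: (rmorph_mmap (g := poly_K)) => [a|j] /=.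
    by rewrite poly_KC.
  rewrite /h; case: eqP => [jN|/eqP jN].
    by rewrite poly_KE map_polyX hornerX jN.
  by rewrite poly_KC; apply: (congr1 t); apply: unbumpK.
have /rational_inP[n [p [q [q0 ->]]]] := t_gen x.
exists (mmap (polyC \o base_K) (@h n) p), (mmap (polyC \o base_K) (@h n) q).
split; last by rewrite -(hE n p) -(hE n q).
apply: contraNneq q0 => q0; rewrite -(hE n q) q0; apply/eqP; exact: (rmorph0 poly_K).
Qed.

(** Indices below [N] are fixed by [bump N], so elements involving only the first N variables
    already lie in [K]. *)
Lemma rat_field_small a : (exists n (p q : mpoly n k0),
  [/\ (n <= N)%N, mev i t q != 0 & a = mev i t p / mev i t q]) ->
  exists b : K, poly_K b%:P = a.
Proof.
move=> [n [p [q [nN q0 aE]]]].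
have st (r : mpoly n k0) : mev i s r = mev i t r.
  congr (mmap _ _ _); apply/funext => j /=.
  by rewrite /s /= /bump leqNgt (leq_trans (ltn_ord j) nN).
have aK : a \in rational_in i s by apply/rational_inP; exists n, p, q; rewrite !st.
by exists (Sub a aK); rewrite poly_KC SubK.
Qed.

End FlexibleStep.
End FlexibleStep.
Import FlexibleStep.

(** * Symbols of linear forms *)

Lemma flexible_step (k : fieldType) (A : seq k) : flexible k ->
  exists (K : fieldType) (phi : {rmorphism {poly K} -> k}),
    [/\ flexible K, is_frac phi & {in A, forall a, exists b, phi b%:P = a}].
Proof.
move=> [k0 [i [t [t_indep t_gen]]]].
have gen x : x \in rational_in i t by apply/rational_inP; exact: t_gen.
have [N AN] : exists N, {in A, forall a, exists n (p q : mpoly.mpoly n k0),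
    [/\ (n <= N)%N, mev i t q != 0 & a = mev i t p / mev i t q]}.
  elim: A => [|a A [N AN]]; first by exists 0%N.
  have /rational_inP[n [p [q [q0 aE]]]] := gen a.
  exists (maxn n N) => b; rewrite inE => /predU1P[->|/AN[m [p' [q' [mN q0' bE]]]]].
    by exists n, p, q; rewrite leq_maxl.
  by exists m, p', q'; split=> //; rewrite (leq_trans mN) // leq_maxr.
exists (rat_field i (t \o bump N)), (@poly_K _ _ i t N).
split; [exact: rat_field_flexible|exact: poly_K_frac|].
by move=> a /AN /rat_field_small.
Qed.

Definition nonsingular (K : fieldType) m (M : 'I_m -> 'I_m -> K) :=
  forall v : 'I_m -> K, (forall l, \sum_j v j * M j l = 0) -> forall j, v j = 0.

Lemma symbol_perm (F : fieldType) (s s' : seq (funits F)) :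
  perm_eq s s' -> symbol s = symbol s'.
Proof.
move=> ss'; apply: esym; move: ss' (erefl (symbol s)).
apply: (catCA_perm_ind (P := fun r => symbol r = symbol s)) => s1 s2 s3 <-.
by rewrite !symbol_cat !mulrA (milnorC (symbol s1)).
Qed.

Lemma milnor_1_neq0 (F : fieldType) : 1 != 0 :> milnor F.
Proof.
by apply/eqP => /(congr1 (milnor_aug F)); rewrite rmorph1 rmorph0 => /eqP; rewrite oner_eq0.
Qed.

(* The pivot [M 0 l0] turns the form [l0] into a uniformizer, and the residues of
   the other forms are the linear forms given by its Schur complement. *)
Lemma linear_forms_symbol m (k : fieldType) (A : seq k) : flexible k ->
  exists (K : fieldType) (j : {rmorphism K -> k}) (u : 'I_m -> k),
    {in A, forall a, exists b, j b = a} /\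
    forall M, nonsingular M -> exists e : 'I_m -> funits k,
      (forall l, val (e l) = \sum_i u i * j (M i l)) /\ symbol (codom e) != 0.
Proof.
elim: m k A => [|m IH] k A kflex.
  exists k, idfun, (fun=> 0); split=> [a _|M _]; first by exists a.
  exists (fun _ => exist _ 1 (oner_neq0 k)); split=> [[]//|].
  by rewrite (size0nil (s := codom _)) ?size_codom ?card_ord // symbol_nil milnor_1_neq0.
have [k' [phi [k'flex phi_frac phiA]]] := flexible_step A kflex.
(* Representing [A] by constants of k' lets the induction hypothesis carry them down to [K]. *)
have [A' A'P] : exists A' : seq k', {in A, forall a, exists2 b, b \in A' & phi b%:P = a}.
  elim: A phiA => [|a A IHA] phiA; first by exists [::].
  have [b bE] := phiA a (mem_head _ _).
  have [|A' A'P] := IHA; first by move=> c cA; apply: phiA; rewrite inE cA orbT.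
  exists (b :: A') => c; rewrite inE => /predU1P[->|/A'P[d dA dE]].
    by exists b; rewrite ?mem_head.
  by exists d; rewrite // inE dA orbT.
have [K [j' [u' [j'A NV]]]] := IH k' A' k'flex.
pose j : {rmorphism K -> k} := phi \o polyC \o j'.
pose u (i : 'I_m.+1) := if unlift ord0 i is Some i' then phi (u' i')%:P else phi 'X.
exists K, j, u; split=> [a /A'P[b /j'A[c cb] ba]|M Mns].
  by exists c; rewrite /= cb.
have [l0 M0] : exists l0, M ord0 l0 != 0.
  apply: contrapT => nex; have M0 l : M ord0 l = 0.
    by apply/eqP; apply: contraT => h; case: nex; exists l.
  suff d0 l : \sum_i (i == ord0)%:R * M i l = 0.
    by have /eqP := Mns _ d0 ord0; rewrite eqxx oner_eq0.
  rewrite (bigD1 ord0) //= M0 mulr0 add0r big1 // => i /negPf ->.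
  by rewrite mul0r.
pose c := M ord0 l0.
pose M' (i l : 'I_m) := M (lift ord0 i) (lift l0 l) - M (lift ord0 i) l0 / c * M ord0 (lift l0 l).
(* A vector in the left kernel of the Schur complement extends by the coordinate -S/c to one in the
   left kernel of [M]. *)
have M'ns : nonsingular M'.
  move=> v vM'; pose S := \sum_i v i * M (lift ord0 i) l0.
  pose w i := if unlift ord0 i is Some i' then v i' else - S / c.
  have wE l : \sum_i w i * M i l =
      - S / c * M ord0 l + \sum_i v i * M (lift ord0 i) l.
    rewrite big_ord_recl /w unlift_none; congr (_ + _).
    by apply: eq_bigr => i _; rewrite liftK.
  have wM l : \sum_i w i * M i l = 0.
    rewrite wE; have [l' ->|->] := unliftP l0 l; last by rewrite divfK // addNr.
    rewrite -[RHS](vM' l') /M' [RHS](eq_bigr (fun i => v i * M (lift ord0 i) (lift l0 l')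
      - v i * M (lift ord0 i) l0 * (c^-1 * M ord0 (lift l0 l')))) => [|i _]; last first.
      by rewrite mulrBr !mulrA.
    by rewrite sumrB -mulr_suml -/S addrC !mulNr mulrA.
  by move=> i; have := Mns w wM (lift ord0 i); rewrite /w liftK.
have [e' [e'E e'0]] := NV M' M'ns.
pose rest l := \sum_i u' i * j' (M (lift ord0 i) l).
pose form l : {poly k'} := (j' (M ord0 l))%:P * 'X + (rest l)%:P.
have formE l : phi (form l) = \sum_i u i * j (M i l).
  rewrite big_ord_recl /u unlift_none /form rmorphD rmorphM mulrC; congr (_ + _).
  rewrite /rest !rmorph_sum; apply: eq_bigr => i _.
  by rewrite liftK !rmorphM.
(* The root of the pivot form, seen as a polynomial in the new variable; the place used is X =
   rho. *)
pose rho := - rest l0 / j' c.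
have jc0 : j' c != 0 by rewrite fmorph_eq0.
have form_rho l : (form (lift l0 l)).[rho] = val (e' l).
  rewrite e'E /form hornerD hornerM hornerX !hornerC /rho /rest.
  rewrite [RHS](eq_bigr (fun i => u' i * j' (M (lift ord0 i) (lift l0 l))
      - u' i * j' (M (lift ord0 i) l0) * ((j' c)^-1 * j' (M ord0 (lift l0 l))))); last first.
    by move=> i _; rewrite /M' rmorphB !rmorphM fmorphV mulrBr !mulrA.
  by rewrite sumrB -mulr_suml addrC mulrC !mulNr mulrA.
have form_l0 : form l0 = (j' c)%:P * ('X - rho%:P).
  rewrite /form mulrBr; congr (_ + _); rewrite -polyCM -polyCN /rho.
  by rewrite [j' c * _]mulrC divfK // opprK.
have phi0 := is_frac_eq0 phi_frac.
have Qirr : irreducible_poly ('X - rho%:P) := irredp_XsubC _.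
pose ev : {rmorphism {poly k'} -> k'} := horner_eval rho.
have evQ : ev ('X - rho%:P) = 0 by rewrite /= /horner_eval hornerXsubC subrr.
have [P [P1 [PQ1 PQ2]]] := finite_place_ex phi_frac Qirr evQ.
have form0 l : form l != 0.
  have [l' ->|->] := unliftP l0 l; last by rewrite form_l0 mulf_neq0 ?polyC_eq0 ?polyXsubC_eq0.
  apply: contraTneq (valP (e' l')) => f0; rewrite /= -form_rho f0 horner0.
  by rewrite eqxx.
have phi_form0 l : phi (form l) != 0.
  by rewrite phi0.
pose e l : funits k := exist _ (phi (form l)) (phi_form0 l).
exists e; split=> [l|]; first by rewrite -formE.
have -> : symbol (codom e) = symbol (e l0 :: [seq e (lift l0 l) | l <- enum 'I_m]).
  apply: symbol_perm; rewrite [X in perm_eq _ (_ :: X)](_ : _ =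
    [seq e l | l <- [seq lift l0 l | l <- enum 'I_m]]); last by rewrite -map_comp.
  rewrite -map_cons; apply: perm_map; apply: uniq_perm; first exact: enum_uniq.
    rewrite /= map_inj_uniq ?enum_uniq ?andbT; last exact: lift_inj.
    by apply/mapP => -[l _ /eqP]; rewrite (negPf (neq_lift _ _)).
  move=> l; rewrite mem_enum !inE; apply/esym.
  have [l' ->|->] := unliftP l0 l; last by rewrite eqxx.
  by apply/orP; right; apply: map_f; rewrite mem_enum.
apply/eqP => s0; move/negP: e'0; apply; apply/eqP.
have := congr1 (fun x => (residue P x).2) s0; rewrite rmorph0 symbol_cons rmorphM.
have -> : residue P (symbol [seq e (lift l0 l) | l <- enum 'I_m]) = (symbol (codom e'), 0).
  rewrite /codom /image_mem; elim: (enum 'I_m) => [|l r IHr].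
    by rewrite !symbol_nil rmorph1.
  rewrite /= !symbol_cons rmorphM IHr residue_brk //=.
  have fr0 : ev (form (lift l0 l)) != 0 by rewrite /= /horner_eval form_rho (valP (e' l)).
  have [-> ->] := P1 _ fr0; rewrite tameM /= /horner_eval form_rho.
  by rewrite !mulr0 !mul0r !addr0.
have evc : ev (j' c)%:P != 0 by rewrite /= /horner_eval hornerC.
have [pc rc] := P1 _ evc.
have -> : residue P (brk (val (e l0))) = (brk (j' c), 1).
  rewrite /= form_l0 rmorphM brkM ?phi0 ?polyC_eq0 ?polyXsubC_eq0 // rmorphD.
  rewrite !residue_brk ?phi0 ?polyC_eq0 ?polyXsubC_eq0 // pc rc PQ1 PQ2 brk1 tameD /=.
  by rewrite addr0 add0r /= /horner_eval hornerC.
by rewrite tameM /= mulr0 add0r mul1r mulr0 mul0r addr0.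
Qed.

(** * Elements killed by nonzero symbols *)

(* The Pfister form <<-T_1, ..., -T_m>> represents every value of <T_1, ..., T_m>. *)
Lemma brk_represented (F : fieldType) (r : seq (F * F)) (x : F) : x != 0 ->
  x = \sum_(c <- r) c.1 * c.2 ^+ 2 -> (\prod_(c <- r) brk (- c.1)) * brk x = 0.
Proof.
elim: r x => [|[T w] r IH] x x0.
  by rewrite [in X in X -> _]big_nil => /eqP; rewrite (negPf x0).
rewrite !big_cons /=; set y := \sum_(c <- r) _; set pi := \prod_(c <- r) _ => xE.
have piy : y != 0 -> pi * brk y = 0 by move=> y0; exact: IH.
have [T0|T0] := eqVneq T 0; first by rewrite T0 oppr0 brk0 !mul0r.
have [w0|w0] := eqVneq w 0.
  have xy : x = y by rewrite xE w0 expr0n mulr0 add0r.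
  by rewrite -mulrA xy piy ?mulr0 // -xy.
have [y0|y0] := eqVneq y 0.
  rewrite milnorC mulrA xE y0 addr0 brkMsqr // brk_mulN.
  by rewrite mul0r.
(* From x = T w^2 + y one gets ({x} + {y})({-T} + {y}) = 0. Multiplying by [pi], which kills {y},
   leaves only the term [pi] {x}{-T}. *)
have st : x / y + (- T * w ^+ 2) / y = 1.
  by rewrite -mulrDl mulNr xE addrC addKr divff.
have := brk_steinberg st; rewrite !brk_div ?mulf_neq0 ?oppr_eq0 ?expf_neq0 //.
rewrite brkMsqr // => /(congr1 (fun u => pi * u)); rewrite mulr0 => <-.
rewrite mulrDl !mulrDr [brk x * brk y]milnorC !mulrA piy // !mul0r !addr0.
by rewrite -mulrA milnorC -mulrA.
Qed.

Section Kill.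
Variables (k F : fieldType) (i : {rmorphism k -> F}).
Hypothesis k_flexible : flexible k.
Variables (m : nat) (w : 'I_m -> F).
Hypothesis w_span : forall a, exists c : 'I_m -> k, a = \sum_l i (c l) * w l ^+ 2.
Hypothesis w_free : forall c : 'I_m -> k, \sum_l i (c l) * w l ^+ 2 = 0 -> forall l, c l = 0.

Lemma isotropic_form (c : 'I_m -> k) (e : 'I_m -> funits k) x : x != 0 ->
  symbol (codom e) != 0 -> (forall l, val (e l) = - c l) ->
  x = \sum_l i (c l) * w l ^+ 2 -> isotropic_ideal i (brk x).
Proof.
move=> x0 e0 eE xE; exists (codom e) => //.
have := @brk_represented F [seq (i (c l), w l) | l <- enum 'I_m] x x0.
rewrite symbolE !big_map -enumT big_enum /= => <- //.
by congr (_ * _); apply: eq_bigr => l _; rewrite /= eE rmorphN.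
Qed.

Lemma brk_isotropic a : a != 0 -> ideal_gen (isotropic_ideal i) (brk a).
Proof.
move=> a0.
have [A AE] : exists A : 'I_m -> 'I_m -> k,
    forall j, a * w j ^+ 2 = \sum_l i (A j l) * w l ^+ 2.
  exact: fin_all_exists (fun j => w_span (a * w j ^+ 2)).
have [K [j [u [KA NV]]]] := linear_forms_symbol m [seq A p.1 p.2 | p : 'I_m * 'I_m] k_flexible.
have [B BE] : exists B : 'I_m -> 'I_m -> K, forall r l, j (B r l) = A r l.
  apply: (@fin_all_exists _ _ (fun r (f : 'I_m -> K) => forall l, j (f l) = A r l)) => r.
  apply: (@fin_all_exists _ _ (fun l (b : K) => j b = A r l)) => l.
  by apply: KA; apply/codomP; exists (r, l).
have [e1 [e1E e10]] : exists e : 'I_m -> funits k,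
    (forall l, val (e l) = - u l) /\ symbol (codom e) != 0.
  (* The matrix -1 yields the symbol of the -u_l. *)
  have [|e [eE e0]] := NV (fun r l => - (r == l)%:R).
    move=> v vM l; apply/eqP; rewrite -oppr_eq0 -[X in _ == X](vM l).
    rewrite (bigD1 l) //= eqxx mulrN1 big1 ?addr0 // => r /negPf ->.
    by rewrite oppr0 mulr0.
  exists e; split=> // l; rewrite eE (bigD1 l) //= eqxx rmorphN1 mulrN1 big1 ?addr0 //.
  by move=> r /negPf ->; rewrite oppr0 rmorph0 mulr0.
pose v l := \sum_r u r * A r l.
have [e2 [e2E e20]] : exists e : 'I_m -> funits k,
    (forall l, val (e l) = - v l) /\ symbol (codom e) != 0.
  (* The matrix of multiplication by -a yields the symbol of the -v_l; it is nonsingular since a is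
     nonzero and the squares form a basis. *)
  have [|e [eE e0]] := NV (fun r l => - B r l).
    move=> c cM; suff h : forall l, j (c l) = 0 by move=> l; apply/eqP; rewrite -(fmorph_eq0 j) h.
    apply: w_free; apply: (mulfI a0); rewrite mulr0 mulr_sumr.
    rewrite (eq_bigr (fun r => \sum_l i (j (c r) * A r l) * w l ^+ 2)); last first.
      by move=> r _; rewrite mulrCA AE mulr_sumr; apply: eq_bigr => l _; rewrite rmorphM mulrA.
    rewrite exchange_big big1 // => l _; rewrite -mulr_suml -rmorph_sum /=.
    suff -> : \sum_r j (c r) * A r l = 0 by rewrite rmorph0 mul0r.
    apply/eqP; rewrite -oppr_eq0 -[X in _ == X](rmorph0 j) -(cM l) rmorph_sum -sumrN.
    by apply/eqP; apply: eq_bigr => r _; rewrite rmorphM rmorphN BE mulrN.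
  exists e; split=> // l; rewrite eE -sumrN; apply: eq_bigr => r _.
  by rewrite rmorphN BE mulrN.
pose x := \sum_l i (u l) * w l ^+ 2.
(* If x = 0, all u_l vanish, although each -u_l is a unit; this leaves only m = 0, where a = 0. *)
have x0 : x != 0.
  apply: contraNneq a0 => /w_free u0; have [c ->] := w_span a; rewrite big1 // => l _.
  by have := valP (e1 l); rewrite /= e1E u0 oppr0 eqxx.
have ax0 : a * x != 0 by rewrite mulf_neq0.
have Ix := isotropic_form x0 e10 e1E erefl.
have Iax : isotropic_ideal i (brk (a * x)).
  apply: (isotropic_form ax0 e20 e2E); rewrite mulr_sumr.
  rewrite (eq_bigr (fun r => \sum_l i (u r * A r l) * w l ^+ 2)); last first.
    by move=> r _; rewrite mulrCA AE mulr_sumr; apply: eq_bigr => l _; rewrite rmorphM mulrA.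
  by rewrite exchange_big; apply: eq_bigr => l _; rewrite -mulr_suml -rmorph_sum.
have -> : brk a = brk (a * x) + brk x by rewrite brkM // -addrA f2addrr addr0.
have [[_ SD] _] := ideal_gen_is_ideal (isotropic_ideal i).
by have := SD 1 _ _ (sub_ideal_gen Iax) (sub_ideal_gen Ix); rewrite scale1r.
Qed.

End Kill.

(** * The isotropic quotients *)

(** A maximal free family of squares spans all squares, and these span F because a = ((a + 1)/2)^2 -
    ((a - 1)/2)^2. *)
Lemma square_basis (k : fieldType) (F : fieldExtType k) : 2%:R != 0 :> k ->
  exists m (w : 'I_m -> F),
    (forall a, exists c : 'I_m -> k, a = \sum_l (GRing.in_alg F) (c l) * w l ^+ 2) /\
    (forall c : 'I_m -> k, \sum_l (GRing.in_alg F) (c l) * w l ^+ 2 = 0 -> forall l, c l = 0).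
Proof.
move=> two0; pose sq (s : seq F) := [seq x ^+ 2 | x <- s].
pose P n := `[< exists s, size s = n /\ free (sq s) >].
have P0 : exists n, P n by exists 0%N; apply/asboolP; exists [::]; rewrite nil_free.
have Pbound n : P n -> (n <= \dim {:F})%N.
  move=> /asboolP[s [<- /eqP sfree]]; rewrite -(size_map (fun x : F => x ^+ 2)) -sfree.
  exact/dimvS/subvf.
have [m /asboolP[s [sm sfree]] mmax] := ex_maxnP P0 Pbound.
have sqU x : x ^+ 2 \in <<sq s>>%VS.
  apply: contraT => nx; have := mmax m.+1; rewrite ltnn => -> //.
  by apply/asboolP; exists (x :: s); rewrite /= sm free_cons nx.
have U a : a \in <<sq s>>%VS.
  have two0F : (2%:R : F) != 0.
    by rewrite -(rmorph_nat (in_alg F)) fmorph_eq0.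
  have -> : a = ((a + 1) / 2%:R) ^+ 2 - ((a - 1) / 2%:R) ^+ 2.
    rewrite subr_sqr -mulrBl -mulrDl.
    have -> : a + 1 - (a - 1) = 2%:R by rewrite opprB addrCA [a + 1]addrC addrK -mulr2n.
    have -> : a + 1 + (a - 1) = a * 2%:R by rewrite addrACA subrr addr0 mulr_natr.
    by rewrite divff // mul1r mulfK.
  by rewrite memvB.
pose X := in_tuple (sq s); pose w (l : 'I_(size (sq s))) := s`_l.
have XE (l : 'I_(size (sq s))) : X`_l = w l ^+ 2.
  by rewrite /X /= (nth_map 0) //; apply: leq_trans (ltn_ord l) _; rewrite size_map.
exists (size (sq s)), w; split=> [a|c c0 l].
  exists (fun l => coord X l a); rewrite {1}(coord_span (U a : a \in <<X>>%VS)).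
  by apply: eq_bigr => l _; rewrite mulr_algl XE.
have /freeP := sfree : free X; apply; rewrite -[RHS]c0.
by apply: eq_bigr => r _; rewrite mulr_algl XE.
Qed.

Lemma galg_iso_sym A B : galg_iso A B -> galg_iso B A.
Proof.
move=> [f [[g fK gK] fdeg]].
have gB : {morph g : x y / x - y}.
  by move=> x y; apply: (can_inj fK); rewrite rmorphB !gK.
have gM : monoid_morphism g.
  by split=> [|x y]; apply: (can_inj fK); rewrite ?rmorph1 ?rmorphM !gK.
pose mA := GRing.isZmodMorphism.Build _ _ g gB.
pose mM := GRing.isMonoidMorphism.Build _ _ g gM.
pose G : {rmorphism B -> A} := HB.pack_for {rmorphism B -> A} g mA mM.
exists G; split=> [|n x]; first by exists f.
by rewrite fdeg /= gK.
Qed.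

Lemma galg_iso_trans A B C : galg_iso A B -> galg_iso B C -> galg_iso A C.
Proof.
move=> [f [fbij fdeg]] [g [gbij gdeg]]; exists (g \o f).
by split=> [|n x]; [exact: bij_comp|rewrite fdeg gdeg].
Qed.

Definition f2_in (A : f2algType) (c : F2) : A := (nat_of_ord c)%:R.

Lemma f2_in0 A : f2_in A 0 = 0. Proof. by []. Qed.

Lemma f2_inD (A : f2algType) : {morph f2_in A : c d / c + d}.
Proof.
move=> c d; have [->|->] := f2P c; have [->|->] := f2P d.
- by rewrite addr0 f2_in0 addr0.
- by rewrite add0r f2_in0 add0r.
- by rewrite addr0 f2_in0 addr0.
- by rewrite [RHS]f2addrr.
Qed.

Lemma galg_F2_iso (B : galg) (h : {rmorphism B -> F2}) :
  (forall x, x = f2_in B (h x)) -> (forall n (x : B), adeg n x <-> n = 0%N \/ x = 0) ->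
  galg_iso B galg_F2.
Proof.
move=> hE Bdeg; have hK : cancel h (f2_in B) by move=> x; rewrite -hE.
have hK' : cancel (f2_in B) h.
  move=> c; have [->|->] := f2P c; first exact: rmorph0.
  exact: rmorph1.
exists h; split=> [|n x]; first by exists (f2_in B).
rewrite Bdeg; case: n => [|n] /=; first by split=> // _; left.
split=> [[//|->]|hx]; first exact: rmorph0.
by right; rewrite (hE x) hx.
Qed.

Section Trivial.
Variables (k F : fieldType) (i : {rmorphism k -> F}).
Hypothesis i_symbol : forall s, symbol s != 0 -> symbol (map (funits_map i) s) != 0.
Hypothesis i_kill : forall a, a != 0 -> ideal_gen (isotropic_ideal i) (brk a).

Let I := isotropic_ideal i.

(** Augmentation 1 would make the image of a nonzero symbol vanish, by [symbol_mul_aug1]. *)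
Lemma isotropic_aug x : I x -> milnor_aug F x = 0.
Proof.
move=> [s s0 sx]; have [//|x1] := f2P (milnor_aug F x).
by have := i_symbol s0; rewrite (symbol_mul_aug1 x1 sx) eqxx.
Qed.

(** All classes {a} die in the quotient, so only the scalar part survives. *)
Lemma api_aug y : api I y = f2_in _ (milnor_aug F y).
Proof.
elim/milnor_ind: y => [||x y hx hy|a y a0 hy].
- by rewrite rmorph0 api0.
- by rewrite rmorph1 api1.
- by rewrite apiD rmorphD f2_inD hx hy.
rewrite rmorphM milnor_aug_brk mul0r apiM.
by have /api_eq0 -> := i_kill a0; rewrite mul0r.
Qed.

Lemma isotropic_milnor_F2 : galg_iso (isotropic_milnor i) galg_F2.
Proof.
have [||||h hE] := @qalg_rec (milnor F) F2 I (milnor_aug F).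
- exact: rmorphD.
- exact: rmorphM.
- exact: rmorph1.
- exact: isotropic_aug.
have hE' (x : qalg I) : x = f2_in (qalg I) (h x) by rewrite -[x]areprK hE -api_aug.
apply: (@galg_F2_iso (isotropic_milnor i) h) => // n x.
have deg0 m : @milnor_deg F m 0.
  by have [] := @span_is_submod (vec (milnor F)) [set x | exists2 s, size s = m & x = symbol s].
split=> [|[->|->]]; last by exists 0; rewrite ?api0.
- case: n => [|n] [y ydeg <-]; [by left|right]; rewrite api_aug.
  suff -> : milnor_aug F y = 0 by [].
  apply: (@span_sub (vec (milnor F)) _ [set y | milnor_aug F y = 0]) ydeg.
    split=> [|c u v /= u0 v0]; first by rewrite /= rmorph0.
    have [->|->] := f2P c; first by rewrite scale0r add0r.
    by rewrite scale1r rmorphD u0 v0 addr0.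
  by move=> _ [s sn ->] /=; rewrite milnor_aug_symbol; case: s sn.
rewrite (hE' x); have [->|->] := f2P (h x); first by exists 0; rewrite ?api0.
exists 1; last by rewrite api1.
by apply: (@Defs.sub_span (vec (milnor F))); exists [::]; rewrite ?symbol_nil.
Qed.

End Trivial.

(** * Koszulity of F2 *)

Lemma morphD0 (U W : zmodType) (f : U -> W) : {morph f : x y / x + y} -> f 0 = 0.
Proof. by move=> fD; apply: (@addrI _ (f 0)); rewrite -fD !addr0. Qed.

Lemma morphDZ (U W : lmodType F2) (f : U -> W) : {morph f : x y / x + y} ->
  forall (c : F2) x, f (c *: x) = c *: f x.
Proof.
move=> fD c x; have [->|->] := f2P c; last by rewrite !scale1r.
by rewrite !scale0r (morphD0 fD).
Qed.

Lemma scaler_inj_f2 (M : lmodType F2) (v : M) : v != 0 -> injective (fun c : F2 => c *: v).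
Proof.
move=> v0 c d; have [->|->] := f2P c; have [->|->] := f2P d; rewrite ?scale0r ?scale1r //.
  by move=> e; rewrite -e eqxx in v0.
by move=> e; rewrite e eqxx in v0.
Qed.

Lemma sub_eq0_eq (M : zmodType) (x y z : M) : x = y -> z = 0 -> x - y = z.
Proof. by move=> -> ->; exact: subrr. Qed.

Lemma subspace_valD (M : lmodType F2) (S : set M) :
  {morph (val : subspace S -> M) : x y / x + y}.
Proof. by []. Qed.

Lemma ker_submod (U W : lmodType F2) (f : U -> W) : {morph f : x y / x + y} ->
  is_submod [set x | f x = 0].
Proof.
move=> fD; split=> [|c x y fx fy]; first exact: morphD0 fD.
by rewrite /mkset fD (morphDZ fD) fx fy scaler0 addr0.
Qed.

Section TensorMap.
Variables (U W U' W' : lmodType F2) (f : U -> U') (g : W -> W').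
Hypotheses (fD : {morph f : x y / x + y}) (gD : {morph g : x y / x + y}).

Lemma tmap_biadditive : biadditive (fun u w => tens (f u) (g w)).
Proof. by split=> [w u u'|u w w']; rewrite ?fD ?gD (tensDl, tensDr). Qed.

Lemma tmap_tens u w : tmap f g (tens u w) = tens (f u) (g w).
Proof. exact: tens_lift_tens tmap_biadditive. Qed.

Lemma tmapD : {morph tmap f g : x y / x + y}.
Proof. exact: tens_liftD tmap_biadditive. Qed.

End TensorMap.

Lemma tens0l (U W : lmodType F2) (w : W) : tens (0 : U) w = 0.
Proof. exact: (morphD0 (fun u u' => tensDl u u' w)). Qed.

Lemma tens0r (U W : lmodType F2) (u : U) : tens u (0 : W) = 0.
Proof. exact: (morphD0 (tensDr u)). Qed.

Lemma tens_neq0 (M : lmodType F2) (eps : M -> F2) (e : M) :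
  {morph eps : x y / x + y} -> eps e = 1 -> tens e e != 0.
Proof.
move=> epsD eps1; pose h (u v : M) : F2^o := eps u * eps v.
have hB : biadditive h by split=> [w u u'|u w w']; rewrite /h epsD (mulrDl, mulrDr).
apply/eqP => /(congr1 (tens_lift h)).
by rewrite tens_lift_tens // (morphD0 (tens_liftD hB)) /h eps1 mulr1 => /eqP; rewrite oner_eq0.
Qed.

Definition is_line (M : lmodType F2) (eps : M -> F2) (e : M) :=
  [/\ {morph eps : x y / x + y}, eps e = 1 & forall x, x = eps x *: e].

Lemma tens_line (M : lmodType F2) (eps : M -> F2) e (w : tensor M M) :
  is_line eps e -> exists c : F2, w = c *: tens e e.
Proof.
move=> [epsD eps1 epsE]; rewrite -[w]qreprK (malgF2E (qrepr _ w)).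
rewrite (big_morph _ (@qpiD _ _) (morphD0 (@qpiD _ _))).
elim/big_rec: _ => [|[u v] y _ [c ->]]; first by exists 0; rewrite scale0r.
rewrite -[qpi _ _]/(tens u v) (epsE u) (epsE v).
have [->|->] := f2P (eps u); first by exists c; rewrite scale0r tens0l add0r.
have [->|->] := f2P (eps v); first by exists c; rewrite scale0r tens0r add0r.
by exists (1 + c); rewrite !scale1r scalerDl scale1r.
Qed.

(** The coalgebra F2 in degree 0, with [e] grouplike. The Koszul dual and Tor are each shown to have
    this form, which makes them isomorphic. *)
Definition line_coalg (C : gcoalg) := exists e : C,
  [/\ is_line (@counit C) e, forall n (x : C), cdeg n x <-> n = 0%N \/ x = 0
    & forall x, comul x = counit x *: tens e e].

Lemma line_coalg_iso C D : line_coalg C -> line_coalg D -> gcoalg_iso C D.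
Proof.
move=> [e [[cD c1 cE] Cdeg Ccomul]] [e' [[dD d1 dE] Ddeg Dcomul]].
pose f (x : C) : D := counit x *: e'.
have flin : linear f.
  move=> c x y; rewrite /f cD scalerDl; congr (_ + _).
  by rewrite (morphDZ (W := F2^o) cD) -scalerA.
pose g (y : D) : C := counit y *: e.
have fcounit x : counit (f x) = counit x.
  by rewrite /f (morphDZ (W := F2^o) dD) d1 [LHS]mulr1.
have gcounit x : counit (g x) = counit x.
  by rewrite /g (morphDZ (W := F2^o) cD) c1 [LHS]mulr1.
pose mL := GRing.isLinear.Build F2 C D _ f flin.
pose L : {linear C -> D} := HB.pack_for {linear C -> D} f mL.
have fD : {morph f : x y / x + y} := raddfD L.
have fK : cancel f g by move=> x; rewrite /g fcounit -cE.
have fe : f e = e' by rewrite /f c1 scale1r.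
have fcomul x : comul (f x) = tmap f f (comul x).
  by rewrite Dcomul fcounit Ccomul (morphDZ (tmapD fD fD)) (tmap_tens fD fD) fe.
have fdeg n x : cdeg n x <-> cdeg n (f x).
  rewrite Cdeg Ddeg; split=> -[->|x0]; by [left|right; rewrite x0 (morphD0 fD)|
    left|right; rewrite -(fK x) x0 /g (morphD0 (W := F2^o) dD) scale0r].
have gK : cancel g f by move=> y; rewrite /f gcounit -dE.
by exists L; split=> //; exists g.
Qed.

Section CounitTensor.
Variable V : lmodType F2.

Lemma tcounitD : {morph @tcounit V : x y / x + y}.
Proof. exact: tliftD (@tcounit_multiadditive V). Qed.

Lemma tcounit_word_eq s : tcounit (tword s : vec (tensor_alg V)) = (nilp s)%:R.
Proof. exact: tlift_word (@tcounit_multiadditive V). Qed.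

Lemma deconcatD : {morph @deconcat V : x y / x + y}.
Proof. exact: tliftD (@deconcat_multiadditive V). Qed.

Local Notation one := (tword [::] : vec (tensor_alg V)).

Lemma tword_nil : one = (1 : tensor_alg V). Proof. by rewrite /tword fword0. Qed.

Lemma tcounit1 : tcounit one = 1. Proof. by rewrite tcounit_word_eq. Qed.

Lemma deconcat1 : deconcat one = tens one one.
Proof.
rewrite /deconcat (tlift_word _ (@deconcat_multiadditive V)) /deconcat_word /=.
by rewrite big_ord1.
Qed.

Lemma tens_one_neq0 : tens one one != 0.
Proof. exact: tens_neq0 tcounitD tcounit1. Qed.

Lemma tdeg_counit n (x : vec (tensor_alg V)) : (0 < n)%N -> tdeg n x -> tcounit x = 0.
Proof.
move=> n0; apply: (Defs.span_sub (ker_submod (W := F2^o) tcounitD)).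
by move=> _ [s sn ->] /=; rewrite tcounit_word_eq; case: s sn n0 => // <-.
Qed.

Lemma tdeg0_one : tdeg 0 one.
Proof. by apply: (@Defs.sub_span (vec (tensor_alg V))); exists [::]. Qed.

Lemma tword_zero s t : tword (s ++ 0 :: t) = 0 :> vec (tensor_alg V).
Proof. by apply: (@addrI _ (tword (s ++ 0 :: t))); rewrite -twordD !addr0. Qed.

End CounitTensor.

Lemma span0 (M : lmodType F2) (S : set M) : Defs.span S 0.
Proof. by have [] := span_is_submod S. Qed.

Lemma spanZ (M : lmodType F2) (S : set M) c x : Defs.span S x -> Defs.span S (c *: x).
Proof.
by move=> Sx; have [S0 SD] := span_is_submod S; rewrite -[_ *: _]addr0; apply: SD.
Qed.

Lemma line_iff (M : lmodType F2) (eps : M -> F2) e (P : nat -> M -> Prop) :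
  is_line eps e -> (forall n c x, P n x -> P n (c *: x)) -> P 0%N e ->
  (forall n, P n 0) -> (forall n x, (0 < n)%N -> P n x -> eps x = 0) ->
  forall n x, P n x <-> n = 0%N \/ x = 0.
Proof.
move=> [_ _ epsE] PZ P0 Pz Peps n x; split=> [Px|[->|-> //]].
  have [->|n0] := posnP n; [by left|right].
  by rewrite (epsE x) (Peps n x) ?scale0r.
by rewrite (epsE x); apply: PZ.
Qed.

(** * The coalgebra Tor of F2 *)

Section TorLine.
Variable A : galg.
Hypothesis A_iso : galg_iso A galg_F2.

Local Notation T := (bar_ambient A).
Local Notation one := (tword [::] : bar_ambient A).

Lemma aug_ideal0 a : aug_ideal a -> a = 0 :> vec A.
Proof.
apply: (@Defs.span_sub (vec A) _ [set a | a = 0]).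
  by split=> // c x y /= -> ->; rewrite scaler0 addr0.
move=> x [n n0]; have [f [[g fK _] fdeg]] := A_iso; rewrite fdeg.
by case: n n0 => // n _ /= fx; rewrite -(fK x) fx -(rmorph0 f) fK.
Qed.

(** The augmentation ideal is zero, so every nonempty word of the bar complex contains the letter 0
    and vanishes. *)
Lemma barE (x : T) : bar x -> x = tcounit x *: one.
Proof.
apply: (@Defs.span_sub T _ [set x | x = tcounit x *: one]).
  split=> [|c y z /= yE zE]; first by rewrite /= (morphD0 (@tcounitD _)) scale0r.
  rewrite /= {1}yE {1}zE tcounitD scalerDl (morphDZ (W := F2^o) (@tcounitD _)).
  by rewrite -scalerA.
move=> _ [s sa ->] /=; rewrite tcounit_word_eq; case: s sa => [|a s] sa.
  by rewrite scale1r.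
have a0 : a = 0 by apply: aug_ideal0; apply: sa; exact: mem_head.
rewrite a0 scale0r.
exact: (tword_zero [::]).
Qed.

Lemma bar_one : bar one.
Proof. by apply: (@Defs.sub_span T); exists [::]. Qed.

Lemma bar_dD : {morph @bar_d A : x y / x + y}.
Proof. exact: tliftD (@bar_dword_multiadditive A). Qed.

Lemma bar_d_one : bar_d one = 0.
Proof. by rewrite /bar_d (tlift_word _ (@bar_dword_multiadditive A)). Qed.

Lemma bar_d0 (x : T) : bar x -> bar_d x = 0.
Proof. by move/barE ->; rewrite (morphDZ bar_dD) bar_d_one scaler0. Qed.

Lemma one_cycle : one \in spanp [set x : T | bar x /\ bar_d x = 0].
Proof.
apply/spanpP; apply: (@Defs.sub_span T); split; [exact: bar_one|exact: bar_d_one].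
Qed.

Definition cycle_one : bar_cycles A := Sub one one_cycle.

Lemma cycle_bar (z : bar_cycles A) : bar (val z).
Proof.
have /spanpP := valP z; apply: (@Defs.span_sub T); last by move=> x [].
exact: span_is_submod.
Qed.

Lemma val_cyclesD : {morph (val : bar_cycles A -> T) : x y / x + y}.
Proof. exact: subspace_valD. Qed.

Lemma cycle_line : is_line (fun z : bar_cycles A => tcounit (val z)) cycle_one.
Proof.
have D : {morph (fun z : bar_cycles A => tcounit (val z)) : x y / x + y}.
  by move=> x y; rewrite val_cyclesD tcounitD.
split; first exact: D; first exact: tcounit1.
move=> x; apply: val_inj; rewrite (morphDZ val_cyclesD).
exact: barE (cycle_bar x).
Qed.

Lemma boundaries0 (z : bar_cycles A) : Defs.span (@bar_boundaries A) z -> z = 0.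
Proof.
apply: (@Defs.span_sub _ _ [set z | z = 0]).
  by split=> // c x y /= -> ->; rewrite scaler0 addr0.
by move=> x [y /bar_d0 ->] /= x0; apply: val_inj.
Qed.

Lemma tor_classK : cancel (@tor_class A) (qrepr (@bar_boundaries A)).
Proof.
move=> z; apply/eqP; rewrite -subr_eq0; apply/eqP/boundaries0; exact: qrepr_pi.
Qed.

Lemma tor_classD : {morph @tor_class A : x y / x + y}.
Proof. exact: qpiD. Qed.

Lemma tor_line : is_line (@counit (tor A)) (tor_class cycle_one).
Proof.
have [cD c1 cE] := cycle_line; split=> [x y||x].
- by rewrite -[x]qreprK -[y]qreprK -tor_classD /= !tor_classK cD.
- by rewrite /= tor_classK.
by rewrite -{1}[x]qreprK /= -(morphDZ tor_classD) -cE.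
Qed.

Lemma bar2_dD : {morph @bar2_d A : x y / x + y}.
Proof.
move=> x y; rewrite /bar2_d (tmapD bar_dD (fun _ _ => erefl)) (tmapD (fun _ _ => erefl) bar_dD).
exact: addrACA.
Qed.

Lemma tor_line_coalg : line_coalg (tor A).
Proof.
have [cD c1 cE] := cycle_line; exists (tor_class cycle_one); split; first exact: tor_line.
  apply: (line_iff tor_line) => [n c _ [z zn <-]||n|n _ n0 [z zn <-]].
  - exists (c *: z); last by rewrite (morphDZ tor_classD).
    by change (tdeg n (val (c *: z))); rewrite (morphDZ val_cyclesD); exact: spanZ.
  - by exists cycle_one => //; exact: tdeg0_one.
  - by exists 0; [exact: span0|exact: (morphD0 tor_classD)].
  - by rewrite /= tor_classK; exact: (tdeg_counit n0).
move=> h; have hE : h = counit h *: tor_class cycle_one by have [_ _] := tor_line; apply.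
set c := counit h in hE *.
(* The coproduct is defined by choice. Existence is witnessed by the multiple of the grouplike
   tensor with zero boundary; uniqueness holds because [bar2_d] vanishes on [bar2]. *)
apply: xget_unique.
  exists (c *: cycle_one), (c *: tens cycle_one cycle_one).
  split; first by rewrite (morphDZ tor_classD).
    by rewrite (morphDZ (tmapD tor_classD tor_classD)) (tmap_tens tor_classD tor_classD).
  exists 0; first exact: span0.
  rewrite (morphDZ val_cyclesD) (morphDZ (@deconcatD _)) deconcat1.
  rewrite (morphDZ (tmapD val_cyclesD val_cyclesD)) (tmap_tens val_cyclesD val_cyclesD).
  exact: (sub_eq0_eq erefl (morphD0 bar2_dD)).
move=> w [z [d [zh <- [b b2 bE]]]].
have [g dE] := tens_line d cycle_line.
have b0 : bar2_d b = 0.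
  apply: (Defs.span_sub (ker_submod bar2_dD)) b2.
  move=> _ [u [v [ub vb ->]]]; rewrite /mkset.
  rewrite /bar2_d (tmap_tens bar_dD (fun _ _ => erefl)) (tmap_tens (fun _ _ => erefl) bar_dD).
  by rewrite !bar_d0 // tens0l tens0r addr0.
have zE : val z = c *: one.
  rewrite (barE (cycle_bar z)); congr (_ *: _).
  by rewrite /c -zh /= tor_classK.
move: bE; rewrite b0 zE dE (morphDZ (@deconcatD _)) deconcat1.
rewrite !(morphDZ (tmapD val_cyclesD val_cyclesD)) (tmap_tens val_cyclesD val_cyclesD).
move=> /subr0_eq /(scaler_inj_f2 (tens_one_neq0 (vec A))) ->.
by rewrite (morphDZ (tmapD tor_classD tor_classD)) (tmap_tens tor_classD tor_classD).
Qed.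

End TorLine.

(** * The quadratic algebra on the zero space *)

Section TrivialQuadratic.
Let V : lmodType F2 := 'rV[F2]_0.
Let T : lmodType F2 := vec (tensor_alg V).
Let R : set T := [set 0].
Local Notation one := (tword [::] : T).

(** The only letter is 0, so every nonempty word vanishes. *)
Lemma tensor_trivialE (x : T) : x = tcounit x *: one.
Proof.
have D := @tcounitD V.
suff [-> | ->] : x = 0 \/ x = one.
- by rewrite (morphD0 D) scale0r.
- by rewrite tcounit1 scale1r.
rewrite -[x](@areprK _ (@tensor_alg_rel V) x).
have [s ->] := free_alg_words (arepr (@tensor_alg_rel V) x).
rewrite api_sum; elim/big_rec: _ => [|w y _ IH]; first by left.
have -> : api (@tensor_alg_rel V) (fword w) = (if w is [::] then one else 0) :> T.
  case: w => [//|a w]; rewrite (_ : a = 0); last by apply/rowP => -[].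
  exact: (tword_zero [::]).
by case: w IH => [|_ w] [->|->]; rewrite ?addr0 ?add0r ?f2addrr; [right|left|left|right].
Qed.

Lemma kdual_deg_trivial n (x : T) : kdual_deg R n x <-> n = 0%N \/ x = 0.
Proof.
split=> [[xn _]|[->|->]].
- have [->|n0] := posnP n; [by left|right].
  by rewrite (tensor_trivialE x) (tdeg_counit n0 xn) scale0r.
- split=> [|i j]; last by rewrite addn2.
  by rewrite (tensor_trivialE x); apply: spanZ; exact: tdeg0_one.
- by split=> [|i j _]; exact: span0.
Qed.

Lemma one_kdual : one \in spanp (\bigcup_n kdual_deg R n).
Proof.
apply/spanpP; apply: (@Defs.sub_span T); exists 0%N => //.
by apply/kdual_deg_trivial; left.
Qed.

Definition kdual_one : kdual_space R := Sub one one_kdual.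

Lemma val_kdualD : {morph (val : kdual_space R -> T) : x y / x + y}.
Proof. exact: subspace_valD. Qed.

Lemma kdual_line : is_line (@counit (kdual R)) kdual_one.
Proof.
split.
- move=> x y; change (tcounit (val (x + y : kdual_space R)) = tcounit (val x) + tcounit (val y)).
  by rewrite val_kdualD tcounitD.
- exact: tcounit1.
move=> x; apply: val_inj; rewrite (morphDZ val_kdualD).
exact: tensor_trivialE.
Qed.

Lemma kdual_line_coalg : line_coalg (kdual R).
Proof.
have [cD c1 cE] := kdual_line.
exists kdual_one; split=> [|n x|x]; first exact: kdual_line.
  rewrite -[cdeg n x]/(kdual_deg R n (val x)) kdual_deg_trivial.
  by split=> -[->|x0]; [left|right; apply: val_inj|left|right; rewrite x0].
have vD := tmapD val_kdualD val_kdualD.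
have dE : deconcat (val x) = counit x *: tens one one.
  by rewrite [val x in LHS]tensor_trivialE (morphDZ (@deconcatD _)) deconcat1.
apply: xget_unique.
  by rewrite /mkset dE (morphDZ vD) (tmap_tens val_kdualD val_kdualD).
move=> w; have [g ->] := tens_line w kdual_line.
rewrite /mkset (morphDZ vD) (tmap_tens val_kdualD val_kdualD) dE.
by move=> /(scaler_inj_f2 (tens_one_neq0 V)) ->.
Qed.

Lemma quadratic_trivial_F2 : galg_iso (quadratic_alg R) galg_F2.
Proof.
pose g := free_ext (fun _ : V => 0 : F2).
have [||||h hE] := @qalg_rec _ F2 (@tensor_alg_rel V) g.
- exact: free_extD.
- exact: free_extM.
- exact: free_ext1.
- by move=> x [u [v ->]]; rewrite /g !free_extB !free_ext_word !big_seq1 !subr0.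
have [||||h' h'E] := @qalg_rec (tensor_alg V) F2 R h.
- exact: rmorphD.
- exact: rmorphM.
- exact: rmorph1.
- by move=> _ ->; exact: rmorph0.
apply: (@galg_F2_iso (quadratic_alg R) h') => [x|n x].
  rewrite -[x]areprK h'E (tensor_trivialE (arepr (R : set (tensor_alg V)) x)).
  set c := tcounit _; have [->|->] := f2P c.
    by rewrite scale0r api0 rmorph0.
  by rewrite scale1r tword_nil api1 rmorph1.
split=> [[y yn <-]|[->|->]].
- have [->|n0] := posnP n; [by left|right].
  by rewrite (tensor_trivialE y) (tdeg_counit n0 yn) scale0r api0.
- exists (arepr (R : set (tensor_alg V)) x); last exact: areprK.
  by rewrite (tensor_trivialE (arepr _ x)); apply: spanZ; exact: tdeg0_one.
- by exists 0; [exact: span0|exact: api0].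
Qed.

End TrivialQuadratic.

Lemma koszul_F2 A : galg_iso A galg_F2 -> koszul A.
Proof.
move=> A_iso; exists 'rV[F2]_0, [set 0]; split.
- by split=> // c x y -> ->; rewrite scaler0 addr0.
- by move=> _ ->; exact: span0.
- exact: galg_iso_trans A_iso (galg_iso_sym quadratic_trivial_F2).
- by apply: line_coalg_iso; [exact: kdual_line_coalg|exact: tor_line_coalg].
Qed.

Theorem proposition6p6 (k : fieldType) (F : fieldExtType k)
  (k_flexible : flexible k)
  (k_char_neq2 : 2%N \notin [pchar k])
  (F_odd : odd (\dim {:F}%VS)) :
  [/\ galg_iso (isotropic_milnor (GRing.in_alg F : {rmorphism k -> F}))
               (isotropic_milnor (idfun : {rmorphism F -> F})),
      galg_iso (isotropic_milnor (idfun : {rmorphism F -> F}))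
               (isotropic_milnor (idfun : {rmorphism k -> k})),
      galg_iso (isotropic_milnor (idfun : {rmorphism k -> k})) galg_F2
    & koszul (isotropic_milnor (GRing.in_alg F : {rmorphism k -> F}))].
Proof.
have two0 : 2%:R != 0 :> k by apply: contra k_char_neq2 => h; rewrite inE /=.
pose j := GRing.in_alg F : {rmorphism k -> F}.
have j_symbol s : symbol s != 0 -> symbol (map (funits_map j) s) != 0.
  apply: contraNneq => s0; rewrite -milnor_map_symbol in s0.
  by apply/eqP; apply: (milnor_map_odd F_odd); exact: s0.
have id_symbol (L : fieldType) (s : seq (funits L)) :
    symbol s != 0 -> symbol (map (funits_map (idfun : {rmorphism L -> L})) s) != 0.
  by rewrite -milnor_map_symbol milnor_map_id.
have [m [w [w_span w_free]]] := square_basis F two0.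
have j_kill a : a != 0 -> ideal_gen (isotropic_ideal j) (brk a).
  exact: (brk_isotropic k_flexible w_span w_free).
(* By injectivity, nonzero symbols of k stay nonzero over F, so the isotropic ideal of F/k is
   contained in that of F/F. *)
have F_kill a : a != 0 -> ideal_gen (isotropic_ideal (idfun : {rmorphism F -> F})) (brk a).
  move/j_kill; apply: (ideal_gen_sub (ideal_gen_is_ideal _)) => x [s s0 sx].
  apply: sub_ideal_gen; exists (map (funits_map j) s); first exact: j_symbol.
  by rewrite -milnor_map_symbol milnor_map_id.
have k_kill a : a != 0 -> ideal_gen (isotropic_ideal (idfun : {rmorphism k -> k})) (brk a).
  (* Over k itself the basis of squares is the single element 1. *)
  apply: (brk_isotropic k_flexible (w := fun _ : 'I_1 => 1)) => [b|c c0 l].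
    by exists (fun=> b); rewrite big_ord1 expr1n mulr1.
  by move: c0; rewrite big_ord1 expr1n mulr1 (ord1 l).
have jF2 := isotropic_milnor_F2 j_symbol j_kill.
have FF2 := isotropic_milnor_F2 (id_symbol F) F_kill.
have kF2 := isotropic_milnor_F2 (id_symbol k) k_kill.
split=> //.
- exact: galg_iso_trans jF2 (galg_iso_sym FF2).
- exact: galg_iso_trans FF2 (galg_iso_sym kF2).
- exact: koszul_F2.
Qed.
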